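(* Let $K$ be a field and let $\mathcal{P}_{\mathcal{A}}$ be the transversal polymatroid presented by a family $\mathcal{A}=(A_1,\ldots,A_s)$ of nonempty subsets of $[n]$ with $A_1\cup\cdots\cup A_s=[n]$. Then $\mathrm{Cl}(R_{\mathcal{P}_{\mathcal{A}}})$ is isomorphic to $\mathbb{Z}$ or to $\mathbb{Z}\oplus\mathbb{Z}/d\mathbb{Z}$ for some integer $d>1$ if and only if, after a suitable reordering of $A_1,\ldots,A_s$, one of the following conditions is satisfied: (i) There is a decomposition $[n]=B\cup C$ with $B\neq\emptyset$, $C\neq\emptyset$, $B\cap C=\emptyset$ for which, for some $1\le q<s$, one has $A_1=\cdots=A_q=B$ and $A_{q+1}=\cdots=A_s=C$. (ii) There is a nonempty subset $A\subsetneq[n]$ for which, for some $1\le q<s$, one has $A_1=\cdots=A_q=A$ and $A_{q+1}=\cdots=A_s=[n]$. Moreover, when (i) or (ii) holds with such a $q$: $\mathrm{Cl}(R_{\mathcal{P}_{\mathcal{A}}})\cong\mathbb{Z}$ if and only if $q$ and $s-q$ are relatively prime; and if the greatest common divisor of $q$ and $s-q$ is $d>1$, then $\mathrm{Cl}(R_{\mathcal{P}_{\mathcal{A}}})\cong\mathbb{Z}\oplus\mathbb{Z}/d\mathbb{Z}$.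
   Context: Let $[n]=\{1,\ldots,n\}$ and let $\mathbf{e}_1,\ldots,\mathbf{e}_n$ be the standard basis of $\mathbb{Z}^n$; $\mathbf{u}\le\mathbf{v}$ means $u_i\le v_i$ for all $i$. Repetitions among the $A_i$ are allowed. The transversal polymatroid presented by $\mathcal{A}=(A_1,\ldots,A_s)$ is the set $\mathcal{P}_{\mathcal{A}}$ of all $\mathbf{u}\in\mathbb{Z}_{\ge0}^n$ such that $\mathbf{u}\le\mathbf{e}_{i_1}+\cdots+\mathbf{e}_{i_s}$ for some $i_1\in A_1,\ldots,i_s\in A_s$ (the discrete polymatroid whose set of bases is $\{\mathbf{e}_{i_1}+\cdots+\mathbf{e}_{i_s} : i_k\in A_k\}$; it does not depend on the order of the $A_i$). Its toric ring is $R_{\mathcal{P}_{\mathcal{A}}}=K[\mathbf{x}^{\mathbf{v}}t : \mathbf{v}\in\mathcal{P}_{\mathcal{A}}]\subset K[x_1,\ldots,x_n,t]$, where $\mathbf{x}^{\mathbf{v}}=\prod_i x_i^{v_i}$; it is a normal domain, and $\mathrm{Cl}$ denotes its divisor class group. *)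

(* Defs.v *)
From HB Require Import structures.
From mathcomp Require Import all_boot all_order all_fingroup all_algebra.
From mathcomp Require Import mpoly.

Set Implicit Arguments.
Unset Strict Implicit.
Unset Printing Implicit Defensive.

Import GRing.Theory.
Local Open Scope ring_scope.

(* The K-subalgebra K[G] generated by a subset G. *)
Inductive subalg_gen (K : fieldType) (S : algType K) (G : S -> Prop) :
    S -> Prop :=
| SubalgScalar (c : K) : subalg_gen G c%:A
| SubalgGen (g : S) : G g -> subalg_gen G g
| SubalgAdd (f g : S) :
    subalg_gen G f -> subalg_gen G g -> subalg_gen G (f + g)
| SubalgMul (f g : S) :
    subalg_gen G f -> subalg_gen G g -> subalg_gen G (f * g).

(* Divisor class group of a domain R, given as a subring of a field F, in terms
   of divisorial fractional ideals.  F may be larger than Frac(R): whenever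
   d * I is contained in R with d in R nonzero, I is contained in Frac(R), and
   the same follows for (R : I) when I contains a nonzero element of Frac(R);
   likewise, a scalar x with I = x J lies in Frac(R). *)
Section DivisorClassGroup.
Variables (F : fieldType) (R : F -> Prop).

Record fractional_ideal (I : F -> Prop) : Prop := FractionalIdeal {
  fracid_zero : I 0;
  fracid_add : forall x y, I x -> I y -> I (x + y);
  fracid_mul : forall r x, R r -> I x -> I (r * x);
  fracid_neq0 : exists x, x != 0 /\ I x;
  fracid_denom : exists d, [/\ R d, d != 0 & forall x, I x -> R (d * x)]
}.

(* (R : I) *)
Definition colon (I : F -> Prop) : F -> Prop :=
  fun y => forall x, I x -> R (y * x).

Definition divisorial (I : F -> Prop) : Prop :=
  fractional_ideal I /\ forall x, colon (colon I) x <-> I x.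

Definition ideal_mul (I J : F -> Prop) : F -> Prop :=
  fun x => exists s : seq (F * F),
    (forall p, p \in s -> I p.1 /\ J p.2) /\ x = \sum_(p <- s) p.1 * p.2.

(* Multiplication of divisorial ideals: (R : (R : I J)). *)
Definition div_mul (I J : F -> Prop) : F -> Prop :=
  colon (colon (ideal_mul I J)).

(* I and J differ by a nonzero principal fractional ideal. *)
Definition same_class (I J : F -> Prop) : Prop :=
  exists x, x != 0 /\ forall y, I y <-> exists z, J z /\ y = x * z.

(* Cl(R) is isomorphic to G.  Cl(R) is the quotient of the divisorial ideals,
   under div_mul, by same_class (a group when R is a normal noetherian domain);
   an isomorphism from this quotient onto G is the same as a surjective
   multiplicative map on divisorial ideals, with values in G, whose fibres are
   exactly the classes.  The values of cl at other subsets are irrelevant. *)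
Definition Cl_isog (G : zmodType) : Prop :=
  exists cl : (F -> Prop) -> G,
    [/\ forall I J, divisorial I -> divisorial J ->
          cl (div_mul I J) = cl I + cl J,
        forall g, exists I, divisorial I /\ cl I = g
      & forall I J, divisorial I -> divisorial J ->
          (cl I = cl J <-> same_class I J)].

End DivisorClassGroup.

Section TransversalPolymatroid.
Variables (n s : nat) (A : 'I_s -> {set 'I_n}).

Definition transversal_polymatroid (u : 'X_{1..n}) : Prop :=
  exists i : 'I_s -> 'I_n,
    (forall k, i k \in A k) /\ (u <= \sum_(k < s) U_(i k))%MM.

(* In {mpoly K[n.+1]}, x_1, ..., x_n are the first n variables and t is the
   last one. *)
Definition monomial_xt (K : fieldType) (v : 'X_{1..n}) : {mpoly K[n.+1]} :=
  (\prod_(i < n) 'X_(widen_ord (leqnSn n) i) ^+ v i) * 'X_ord_max.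

Definition toric_ring (K : fieldType) : {mpoly K[n.+1]} -> Prop :=
  subalg_gen (fun f => exists v,
    transversal_polymatroid v /\ f = monomial_xt K v).

(* The toric ring inside the field K(x_1, ..., x_n, t). *)
Definition toric_ring_frac (K : fieldType) :
    {fraction {mpoly K[n.+1]}} -> Prop :=
  fun x => exists f, toric_ring f /\ x = tofrac f.

(* Cl(R_P) is isomorphic to G, for P the transversal polymatroid presented by
   A. *)
Definition toric_Cl_isog (K : fieldType) (G : zmodType) : Prop :=
  Cl_isog (@toric_ring_frac K) G.

(* A_1, ..., A_q are the values A k with k < q, since indices start at 0. *)
Definition condition_i (q : nat) : Prop :=
  (1 <= q < s)%N /\
  exists B C : {set 'I_n},
    [/\ B :|: C = [set: 'I_n], B != set0, C != set0, B :&: C = set0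
      & forall k : 'I_s, A k = if (k < q)%N then B else C].

Definition condition_ii (q : nat) : Prop :=
  (1 <= q < s)%N /\
  exists B : {set 'I_n},
    [/\ B != set0, B \proper [set: 'I_n]
      & forall k : 'I_s, A k = if (k < q)%N then B else [set: 'I_n]].

End TransversalPolymatroid.

(* Main.v *)
Require Import Defs.
From HB Require Import structures.
From mathcomp Require Import all_boot all_order all_fingroup all_algebra.
From mathcomp Require Import mpoly ring zify.
From Stdlib Require Import Classical ClassicalEpsilon.
From Stdlib Require Import FunctionalExtensionality PropExtensionality.

Set Implicit Arguments.
Unset Strict Implicit.
Unset Printing Implicit Defensive.

Import GRing.Theory Order.TTheory Num.Theory.
Local Open Scope ring_scope.

(** For X in [n] let rk(X) be the number of blocks A_k that meet X.  By Hall's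
    theorem the toric ring R is the semigroup ring of the vectors (u, k) with
    u >= 0 and u(X) <= k rk(X) for all X.  Inequalities can be dropped from this
    list: if X can be split into two parts that meet disjoint sets of blocks,
    its inequality is the sum of those of the parts, and if X can be enlarged
    without meeting new blocks, the inequality of the larger set is stronger.
    What remains are the n conditions u_i >= 0 and the inequalities of the
    nonempty sets X that are closed and inseparable; each of them defines a
    facet of the cone (facet_separation).

    The class group of such a semigroup ring is Z^facets modulo the values of
    the facet forms on lattice vectors (Cl_isogP).  The forms u_i already cut
    out the coordinates of u, so Cl(R) is Z^T modulo the vector (rk X)_X, where
    T is the set of closed inseparable sets (toric_Cl_isogP).  This group has
    rank #T - 1 and the torsion subgroup Z/d with d the gcd of the rk X.  Hence
    it is Z or Z + Z/d exactly when #T = 2.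

    To read off #T, assign to i in [n] the set of the blocks that contain i.
    The closures of the singletons are facets, and their number is the number of
    distinct values of this assignment; if two values N1, N2 meet without being
    nested, the closure of a pair is a further facet.  So #T = 2 means that
    there are exactly two values and that they are disjoint, which is the
    condition (i), or nested, which is the condition (ii).  The two ranks are
    q, s - q in the first case and s, s - q in the second.

    The formula for the class group is obtained without the theory of Krull
    domains.  For a divisorial ideal I in the field of fractions, divide by a
    greatest common divisor g of I in the factorial ring K[x, t]; then every y
    that carries the resulting ideal J into R is a polynomial, and as the facet
    forms give valuations (weight_mul), (R : J) is spanned by the monomials with
    prescribed lower bounds on the facet forms.  Then J = (R : (R : J)) is a
    monomial ideal of the same kind (divisorial_principal). *)

(** * Greatest common divisors of arbitrary sets of polynomials *)

Lemma ex_min_measure (T : Type) (P : T -> Prop) (mu : T -> nat) :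
  (exists x, P x) -> exists x, P x /\ forall y, P y -> (mu x <= mu y)%N.
Proof.
case=> x; have [k] := ubnP (mu x); elim: k x => // k IH x lt_k Px.
have [[y [Py lt_y]]|nlt] := classic (exists y, P y /\ (mu y < mu x)%N).
  by apply: (IH y) => //; apply: leq_trans lt_y _; rewrite -ltnS.
exists x; split=> // y Py; rewrite leqNgt; apply/negP => lt_y.
by apply: nlt; exists y.
Qed.

Section SetGcd.
Variable D : idomainType.
Implicit Types (a b c d f g : D) (T : D -> Prop).

Definition divides b a := exists c, a = c * b.

(** The factor a turns this into a condition on fractions: a / b carries T into D
    exactly when it carries g into D.  For a = 1 it is the usual property of a
    greatest common divisor. *)
Definition set_gcd T g :=
  forall a b, (forall f, T f -> divides b (a * f)) <-> divides b (a * g).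

Lemma divides_mull a b c : divides b a -> divides b (c * a).
Proof. by case=> x ->; exists (c * x); rewrite mulrA. Qed.

Lemma divides_mulr a b c : divides b a -> divides b (a * c).
Proof. by rewrite mulrC; apply: divides_mull. Qed.

Lemma dividesD a b c : divides b a -> divides b c -> divides b (a + c).
Proof. by move=> [x ->] [y ->]; exists (x + y); rewrite mulrDl. Qed.

Lemma dividesB a b c : divides b a -> divides b c -> divides b (a - c).
Proof. by move=> [x ->] [y ->]; exists (x - y); rewrite mulrBl. Qed.

Lemma divides_refl a : divides a a.
Proof. by exists 1; rewrite mul1r. Qed.

Lemma divides_trans a b c : divides a b -> divides b c -> divides a c.
Proof. by move=> [x ->] [y ->]; exists (y * x); rewrite mulrA. Qed.

Lemma divides_mul2l a b c : c != 0 -> divides (c * b) (c * a) -> divides b a.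
Proof.
move=> c0 [x E]; exists x; apply: (mulfI c0); rewrite E; ring.
Qed.

Lemma divides_mul a b c d : divides a b -> divides c d -> divides (a * c) (b * d).
Proof. by move=> [x ->] [y ->]; exists (x * y); ring. Qed.

Lemma set_gcd_dvd T g f : set_gcd T g -> T f -> divides g f.
Proof.
move=> gT Tf; have [_ /(_ _ f Tf)] := gT 1 g.
by rewrite !mul1r; apply; apply: divides_refl.
Qed.

End SetGcd.

Definition has_set_gcd (D : idomainType) :=
  forall T : D -> Prop, (exists f, T f /\ f != 0) -> exists g, g != 0 /\ set_gcd T g.

Section Gauss.
Variables (D : idomainType) (gcdD : has_set_gcd D).
Implicit Types (a b c : D) (f g h e : {poly D}).

Definition divides_coefs b f := forall i, divides b f`_i.

(** The content is 1 in the strong sense of [set_gcd]. *)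
Definition primitive f := forall a b, divides_coefs b (a *: f) -> divides b a.

Lemma divides_coefsZ b c f : divides b c -> divides_coefs b (c *: f).
Proof. by move=> bc i; rewrite coefZ; apply: divides_mulr. Qed.

Lemma divides_coefsB b f g :
  divides_coefs b f -> divides_coefs b g -> divides_coefs b (f - g).
Proof. by move=> bf bg i; rewrite coefB; apply: dividesB. Qed.

Lemma divides_coefsP b f : divides_coefs b f <-> exists g, f = b *: g.
Proof.
split=> [bf|[g ->]]; last by apply: divides_coefsZ; apply: divides_refl.
have [h hE] := fin_all_exists (fun i : 'I_(size f) => bf i).
exists (\poly_(i < size f) oapp h 0 (insub i)); apply/polyP => i.
rewrite coefZ coef_poly; case: ltnP => [lt_i|/leq_sizeP->//].
  by rewrite insubT /= mulrC -hE.
by rewrite mulr0.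
Qed.

Lemma content_primitive f : f != 0 ->
  exists c h, [/\ c != 0, f = c *: h & primitive h].
Proof.
move=> f0; have [|c [c0 cP]] := gcdD (T := fun x => exists i, x = f`_i).
  by exists (lead_coef f); rewrite lead_coef_eq0; split=> //; exists (size f).-1.
have /divides_coefsP[h fE] : divides_coefs c f.
  by move=> i; apply: (set_gcd_dvd cP); exists i.
exists c, h; split=> // a b bh; apply: (@divides_mul2l _ _ _ c) => //.
rewrite [_ * a]mulrC; apply/cP => x [i ->]; have := bh i.
rewrite fE !coefZ mulrCA => bhi; apply: divides_mul => //; exact: divides_refl.
Qed.

(** The induction step of Gauss's lemma: once b divides the leading term of f
    up to the factor a, it divides a (f - leading term) g as well, and the first
    factor of that is smaller than f. *)
Lemma primitive_lead f g a b : primitive f -> primitive g ->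
  (forall f1, (size f1 < size f)%N -> primitive f1 -> primitive (f1 * g)) ->
  divides_coefs b (a *: (f * g)) -> divides b (a * lead_coef f) -> divides b a.
Proof.
move=> pf pg IH bfg bx; set x := lead_coef f in bx.
have [f0|f0] := eqVneq f 0.
  by apply: pf; rewrite f0 scaler0 => i; rewrite coef0; exists 0; rewrite mul0r.
pose f1 := f - x *: 'X^((size f).-1).
have lt_f1 : (size f1 < size f)%N.
  have sf : (0 < size f)%N by rewrite size_poly_gt0.
  rewrite -(prednK sf) ltnS; apply/leq_sizeP => j le_j.
  rewrite coefB coefZ coefXn; case: eqVneq => [->|ne]; first by rewrite mulr1 subrr.
  by rewrite mulr0 subr0 nth_default // -(prednK sf) ltn_neqAle eq_sym ne.
apply: (pf); rewrite -[f](subrK (x *: 'X^((size f).-1))) -/f1 scalerDr.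
rewrite -[X in divides_coefs b (_ + X)]opprK; apply: divides_coefsB; last first.
  rewrite scalerA -scaleNr; apply: divides_coefsZ.
  by case: bx => z ->; exists (- z); rewrite mulNr.
have [->|f10] := eqVneq f1 0.
  by rewrite scaler0 => i; rewrite coef0; exists 0; rewrite mul0r.
have [c [h [c0 f1E ph]]] := content_primitive f10.
have lt_h : (size h < size f)%N by rewrite -(size_scale h c0) -f1E.
rewrite f1E scalerA; apply: divides_coefsZ; apply: (IH _ lt_h ph).
rewrite -scalerA scalerAl -f1E mulrBl scalerBr; apply: divides_coefsB => //.
by rewrite -scalerAl scalerA; apply: divides_coefsZ.
Qed.

(** Gauss's lemma in a domain with greatest common divisors, hence without prime
    elements: the leading coefficients x of f and y of g satisfy b | a x y, and a
    common divisor of b and a y already divides a by the previous lemma, so that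
    b | a x. *)
Lemma primitive_mul f g : primitive f -> primitive g -> primitive (f * g).
Proof.
have [k] := ubnP (size f + size g); elim: k f g => // k IH f g lt_k pf pg.
have IHf f1 : (size f1 < size f)%N -> primitive f1 -> primitive (f1 * g).
  by move=> lt1 pf1; apply: IH => //; lia.
have IHg g1 : (size g1 < size g)%N -> primitive g1 -> primitive (g1 * f).
  by move=> lt1 pg1; apply: IH => //; lia.
move=> a b bfg; apply: (primitive_lead pf pg IHf bfg).
set x := lead_coef f; set y := lead_coef g.
have bxy : divides b (a * y * x).
  have := bfg (size (f * g)).-1; rewrite coefZ -lead_coefE lead_coefM.
  by rewrite -mulrA [y * x]mulrC.
have [b0|b0] := eqVneq b 0.
  case: bxy => z /eqP; rewrite b0 mulr0 !mulf_eq0 !lead_coef_eq0 -orbA.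
  have prim0 h : primitive h -> h != 0.
    move=> ph; apply/eqP => h0; have /ph[c /eqP] : divides_coefs 0 (1 *: h).
      by rewrite h0 scaler0 => i; rewrite coef0; exists 0; rewrite mul0r.
    by rewrite mulr0 oner_eq0.
  rewrite (negPf (prim0 _ pf)) (negPf (prim0 _ pg)) !orbF => /eqP ->.
  by exists 0; rewrite !mul0r.
have [|d [d0 dP]] := gcdD (T := fun z => z = b \/ z = a * y).
  by exists b; split=> //; left.
have da : divides d a.
  apply: (@primitive_lead g f) => //; last by apply: (set_gcd_dvd dP); right.
  rewrite mulrC => i; apply: divides_trans (bfg i).
  by apply: (set_gcd_dvd dP); left.
rewrite mulrC; apply: divides_trans (divides_mul (divides_refl x) da).
by apply/dP => z [] ->; [exact/divides_mull/divides_refl|rewrite mulrC].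
Qed.

(** The form in which Gauss's lemma is used: a divisor from the base ring of a
    multiple of the primitive polynomial h divides the cofactor. *)
Lemma primitive_cancel h e a b : primitive h ->
  divides_coefs b (a *: (h * e)) -> divides_coefs b (a *: e).
Proof.
move=> ph bhe; have [->|e0] := eqVneq e 0.
  by rewrite scaler0 => i; rewrite coef0; exists 0; rewrite mul0r.
have [c [e' [c0 eE pe]]] := content_primitive e0.
rewrite eE scalerA; apply: divides_coefsZ; apply: (primitive_mul ph pe).
by rewrite -scalerA scalerAr -eE.
Qed.

End Gauss.

Section PolyGcd.
Variables (D : idomainType) (gcdD : has_set_gcd D).
Implicit Types (a b c : D) (f g h e p : {poly D}).

Inductive span (T : {poly D} -> Prop) : {poly D} -> Prop :=
| Span0 : span T 0
| SpanGen f : T f -> span T f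
| SpanMulD p f g : span T f -> span T g -> span T (p * f + g).

Lemma spanB T f g p : span T f -> span T g -> span T (f - p * g).
Proof.
by move=> sf sg; rewrite addrC -mulNr; apply: SpanMulD.
Qed.

Lemma divides_span T (b a f : {poly D}) : (forall g, T g -> divides b (a * g)) ->
  span T f -> divides b (a * f).
Proof.
move=> bT; elim=> [|g /bT//|p g h _ IHg _ IHh].
  by exists 0; rewrite mulr0 mul0r.
by rewrite mulrDr mulrCA; apply: dividesD => //; apply: divides_mull.
Qed.

(** Over the field of fractions of D, the ideal generated by T is principal, with
    a generator h of least degree; its primitive part h' divides T over D by
    Gauss's lemma.  The gcd of T is h' times the gcd of the coefficients of the
    quotients. *)
Lemma poly_set_gcd : has_set_gcd {poly D}.
Proof.
move=> T [f0 [Tf0 f0nz]].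
have [|h [[sh hnz] hmin]] := @ex_min_measure _
    (fun p => span T p /\ p != 0) (fun p => size p).
  by exists f0; split=> //; apply: SpanGen.
have [c [h' [c0 hE ph]]] := content_primitive gcdD hnz.
have h'nz : h' != 0 by apply: contraNneq hnz => h'0; rewrite hE h'0 scaler0.
have fac f : T f -> exists e, f = e * h'.
  move=> Tf; have := Pdiv.Idomain.divp_eq f h; set k := scalp f h => fE.
  have r0 : (f %% h) = 0.
    apply/eqP/negPn/negP => rnz; have := Pdiv.Idomain.ltn_modp f h.
    rewrite hnz ltnNge => /negP; apply.
    apply: hmin; split=> //.
    suff -> : (f %% h) = (lead_coef h ^+ k)%:P * f + 0 - (f %/ h) * h.
      by apply: spanB => //; apply: SpanMulD; [apply: SpanGen|apply: Span0].
    by rewrite addr0 mul_polyC fE addrC addKr.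
  move: fE; rewrite r0 addr0 => fE.
  have lnz : lead_coef h ^+ k != 0 by rewrite expf_neq0 ?lead_coef_eq0.
  have qhE : (f %/ h) * h = h' * (c *: (f %/ h)).
    by rewrite [in X in _ * X]hE -!mul_polyC; ring.
  have : divides_coefs (lead_coef h ^+ k) (1 *: (c *: (f %/ h))).
    apply: (primitive_cancel gcdD ph); rewrite scale1r -qhE -fE.
    apply: divides_coefsZ; exact: divides_refl.
  rewrite scale1r => /divides_coefsP[e eE]; exists e.
  apply: (mulfI (x := (lead_coef h ^+ k)%:P)); first by rewrite polyC_eq0.
  by rewrite mul_polyC fE qhE eE -!mul_polyC; ring.
pose C x := exists e i, T (e * h') /\ x = e`_i.
have [|g0 [g0nz g0P]] := gcdD (T := C).
  have [e eE] := fac _ Tf0; exists (lead_coef e); split.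
    by exists e, (size e).-1; rewrite -eE.
  by rewrite lead_coef_eq0; apply: contraNneq f0nz => e0; rewrite eE e0 mul0r.
have g0dvd e : T (e * h') -> divides g0%:P e.
  move=> Te; have /divides_coefsP[e' ->] : divides_coefs g0 e.
    by move=> i; apply: (set_gcd_dvd g0P); exists e, i.
  by exists e'; rewrite mulrC mul_polyC.
exists (g0%:P * h'); split; first by rewrite mulf_neq0 ?polyC_eq0.
move=> a b; split=> [bT|bg f Tf]; last first.
  have [e fE] := fac _ Tf; rewrite {}fE in Tf *; apply: divides_trans bg _.
  apply: divides_mul; first exact: divides_refl.
  by apply: divides_mul (g0dvd _ Tf) (divides_refl _).
have [->|anz] := eqVneq a 0; first by exists 0; rewrite !mul0r.
have [b0|bnz] := eqVneq b 0.
  have [x /eqP] := bT _ Tf0; rewrite b0 mulr0 mulf_eq0.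
  by rewrite (negPf anz) (negPf f0nz).
have bh : divides b (a * h) by apply: divides_span sh.
have [be [b' [be0 bE pb]]] := content_primitive gcdD bnz.
have b'nz : b' != 0 by apply: contraNneq bnz => b'0; rewrite bE b'0 scaler0.
(* Since b divides a h = c a h', its primitive part divides a h' *)
have [a' aE] : exists a' : {poly D}, a * h' = b' * a'.
  case: bh => x xE.
  have : divides_coefs c (1 *: (be *: x)).
    apply: (primitive_cancel gcdD pb); rewrite scale1r.
    have -> : b' * (be *: x) = c *: (a * h').
      by rewrite scalerAr -hE xE bE -!mul_polyC; ring.
    by apply: divides_coefsZ; apply: divides_refl.
  rewrite scale1r => /divides_coefsP[y yE]; exists y.
  apply: (mulfI (x := c%:P)); first by rewrite polyC_eq0.
  have -> : c%:P * (b' * y) = b' * (c *: y) by rewrite -!mul_polyC; ring.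
  rewrite -yE mul_polyC scalerAr -hE xE bE -!mul_polyC; ring.
have a'nz : a' != 0.
  apply: contra_neqN (mulf_neq0 anz h'nz) => /eqP a'0; by rewrite aE a'0 mulr0.
have [al [a'' [al0 a'E pa]]] := content_primitive gcdD a'nz.
(* The content be of b only concerns coefficients, where g0 is the gcd *)
have key x : C x -> divides be (al * x).
  case=> e [i [Te ->]]; rewrite -coefZ; move: i.
  apply: (primitive_cancel gcdD pa); apply/divides_coefsP.
  have [y yE] := bT _ Te; exists y; apply: (mulfI b'nz).
  have -> : b' * (al *: (a'' * e)) = a * (e * h').
    have -> : b' * (al *: (a'' * e)) = b' * (al *: a'') * e.
      by rewrite -!mul_polyC; ring.
    by rewrite -a'E -aE; ring.
  by rewrite yE bE -!mul_polyC; ring.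
have [z zE] := (g0P al be).1 key.
exists (z *: a''); rewrite mulrCA aE a'E bE -!mul_polyC.
have -> : g0%:P * (b' * (al%:P * a'')) = (al * g0)%:P * b' * a''.
  by rewrite polyCM; ring.
by rewrite zE polyCM; ring.
Qed.

End PolyGcd.

Lemma set_gcd_iso (D E : idomainType)
    (phi : {rmorphism D -> E}) (psi : {rmorphism E -> D}) :
  cancel phi psi -> cancel psi phi -> has_set_gcd D -> has_set_gcd E.
Proof.
move=> phiK psiK gcdD T [f [Tf fnz]].
have dphi a b : divides a b <-> divides (psi a) (psi b).
  split=> [[c ->]|[c cE]]; first by exists (psi c); rewrite rmorphM.
  by exists (phi c); apply: (can_inj psiK); rewrite rmorphM phiK.
have [|g [gnz gP]] := gcdD (fun x => T (phi x)).
  exists (psi f); rewrite psiK; split=> //.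
  by apply: contraNneq fnz => E0; rewrite -(psiK f) E0 rmorph0.
exists (phi g); split.
  by apply: contraNneq gnz => E0; rewrite -(phiK g) E0 rmorph0.
move=> a b; rewrite dphi rmorphM phiK -gP; split=> H x Tx.
  by rewrite -[x]phiK -rmorphM -dphi; apply: H.
by rewrite dphi rmorphM; apply: H; rewrite psiK.
Qed.

Section MpolyGcd.
Variable K : fieldType.

Definition muni_inv n : {poly {mpoly K[n]}} -> {mpoly K[n.+1]} :=
  horner_eval 'X_ord_max \o map_poly (@mwiden n K).

HB.instance Definition _ n := GRing.RMorphism.on (@muni_inv n).

Lemma muni_invE n (p : {poly {mpoly K[n]}}) :
  muni_inv p = (map_poly (@mwiden n K) p).['X_ord_max].
Proof. by []. Qed.

Lemma muniX n (m : 'X_{1..n.+1}) :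
  @muni n K 'X_[m] =
    'X_[[multinom m (widen_ord (leqnSn n) i) | i < n]] *: 'X^(m ord_max).
Proof. by rewrite muniE msuppX big_seq1 mcoeffX eqxx scale1r. Qed.

Lemma muni_mwiden n (q : {mpoly K[n]}) : muni (mwiden q) = q%:P.
Proof.
elim/mpolyind: q => [|c m p _ _ IH]; first by rewrite mwiden0 muni0.
rewrite mwidenD muniD IH polyCD mwidenZ mwidenX muniZ muniX; congr (_ + _).
rewrite mnmwiden_ordmax expr0 alg_polyC -mul_polyC -polyCM mul_mpolyC.
congr ((c *: 'X_[_])%:P).
by apply/mnmP => i; rewrite mnmE mnmwiden_widen.
Qed.

Lemma muni_invK n : cancel (@muni_inv n) (@muni n K).
Proof.
elim/poly_ind => [|p c IH]; first by rewrite rmorph0 muni0.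
rewrite rmorphD rmorphM muniD muniM IH /= !muni_invE map_polyC map_polyX hornerC hornerX.
rewrite muni_mwiden muniX; congr (_ * _ + _).
rewrite mnm1E eqxx expr1 (_ : [multinom _ | _ < n] = 0%MM) ?mpolyX0 ?scale1r //.
by apply/mnmP => i; rewrite mnmE mnm0E mnm1E -val_eqE /= gtn_eqF.
Qed.

Lemma additive_fixD (V : zmodType) (h : {additive V -> V}) u v :
  h u = u -> h v = v -> h (u + v) = u + v.
Proof. by rewrite raddfD => -> ->. Qed.

Lemma muniK n : cancel (@muni n K) (@muni_inv n).
Proof.
elim/mpolyind => [|c m p _ _ IH]; first by rewrite muni0 rmorph0.
suff XK : muni_inv (muni (c *: 'X_[m])) = c *: 'X_[m].
  exact: (@additive_fixD _ (@muni_inv n \o @muni n K) _ _ XK IH).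
rewrite muniZ muniX -!mul_polyC !rmorphM rmorphXn /=.
have CE q : muni_inv q%:P = mwiden q by rewrite muni_invE map_polyC hornerC.
have XE : muni_inv 'X = 'X_ord_max :> {mpoly K[n.+1]}.
  by rewrite muni_invE map_polyX hornerX.
rewrite !CE XE mwidenC mwidenX mul_mpolyC mpolyXn -mpolyXD; congr (c *: 'X_[_]).
apply/mnmP => i; rewrite mnmDE mulmnE mnm1E.
have [j ->|->] := unliftP ord_max i.
  rewrite -val_eqE /= /bump leqNgt ltn_ord add0n gtn_eqF // addn0.
  have -> : lift ord_max j = widen_ord (leqnSn n) j.
    by apply: val_inj; rewrite /= /bump leqNgt ltn_ord.
  by rewrite mnmwiden_widen mnmE.
by rewrite mnmwiden_ordmax eqxx mul1n.
Qed.

Lemma mpoly_set_gcd n : has_set_gcd {mpoly K[n]}.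
Proof.
elim: n => [|n IH].
  move=> T [f [Tf fnz]]; exists 1; rewrite oner_neq0; split=> // a b.
  rewrite mulr1; split=> [/(_ f Tf)|ba g _]; last exact: divides_mulr.
  move: fnz; rewrite (nvar0_mpolyC f); set x := f@_0; rewrite mpolyC_eq0 => xnz.
  case=> y E; exists (y * (x^-1)%:MP).
  by rewrite mulrAC -E -mulrA -mpolyCM divff // mulr1.
exact: (set_gcd_iso (@muni_invK n) (@muniK n) (poly_set_gcd IH)).
Qed.

End MpolyGcd.

(** * Valuations of polynomials given by additive weights *)

Lemma pred_ext (T : Type) (P Q : T -> Prop) : (forall x, P x <-> Q x) -> P = Q.
Proof.
by move=> PQ; apply: functional_extensionality => x; apply: propositional_extensionality.
Qed.

Section Weight.
Variables (K : fieldType) (n : nat).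
Implicit Types (p q : {mpoly K[n]}) (m : 'X_{1..n}).

Definition mpart (P : pred 'X_{1..n}) p : {mpoly K[n]} :=
  \sum_(m <- msupp p | P m) p@_m *: 'X_[m].

Lemma mcoeff_part P p m : (mpart P p)@_m = if P m then p@_m else 0.
Proof.
rewrite /mpart raddf_sum /=.
under eq_bigr do rewrite mcoeffZ mcoeffX.
have [mp|mp] := boolP (m \in msupp p); last first.
  rewrite big_seq_cond big1 ?memN_msupp_eq0 ?if_same // => k /andP[kp _].
  have /negPf-> : k != m by apply: contraNneq mp => <-.
  by rewrite mulr0.
rewrite big_mkcond (bigD1_seq m) //= ?msupp_uniq // eqxx mulr1 big1 ?addr0 //.
by move=> k /negPf->; rewrite mulr0 if_same.
Qed.

Lemma mpart_split P p : p = mpart P p + mpart (predC P) p.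
Proof.
apply/mpolyP => m; rewrite mcoeffD !mcoeff_part /=.
by case: (P m); rewrite ?addr0 ?add0r.
Qed.

Lemma mem_msuppM p q m : m \in msupp (p * q) ->
  exists m1 m2, [/\ m1 \in msupp p, m2 \in msupp q & m = (m1 + m2)%MM].
Proof.
by move/msuppM_le/allpairsP => [[m1 m2] /= [m1p m2q ->]]; exists m1, m2.
Qed.

Variable lam : 'X_{1..n} -> int.
Hypothesis lamD : forall m m', lam (m + m')%MM = lam m + lam m'.

Lemma min_weight p : p != 0 ->
  exists2 m, m \in msupp p & forall m', m' \in msupp p -> lam m <= lam m'.
Proof.
move=> pnz; have mlp := mlead_supp pnz.
pose s := msupp p; pose w (i : 'I_(size s)) := lam (nth 0%MM s i).
have lt0 : (index (mlead p) s < size s)%N by rewrite index_mem.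
have [i _ imin] := @Order.TotalTheory.arg_minP _ _ _ (Ordinal lt0) predT w isT.
exists (nth 0%MM s i); first by rewrite mem_nth.
move=> m' m'p; have lt' : (index m' s < size s)%N by rewrite index_mem.
by have := imin (Ordinal lt') isT; rewrite /w /= nth_index.
Qed.

(** The least weight in the support is a valuation: the product of the parts of
    p and q of least weight is nonzero and cannot cancel against other terms. *)
Lemma weight_mul p q b : (forall m, m \in msupp (p * q) -> b <= lam m) ->
  forall m1 m2, m1 \in msupp p -> m2 \in msupp q -> b <= lam m1 + lam m2.
Proof.
move=> bpq m1 m2 m1p m2q.
have pnz : p != 0 by apply: contraTneq m1p => ->; rewrite msupp0.
have qnz : q != 0 by apply: contraTneq m2q => ->; rewrite msupp0.
have [a ap amin] := min_weight pnz; have [c cq cmin] := min_weight qnz.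
apply: (@le_trans _ _ (lam a + lam c)); last by rewrite lerD ?amin ?cmin.
pose P m := lam m == lam a; pose Q m := lam m == lam c.
have p0nz : mpart P p != 0.
  apply/eqP => /(congr1 (mcoeff a)); rewrite mcoeff_part /P eqxx mcoeff0.
  by apply/eqP; rewrite -mcoeff_msupp.
have q0nz : mpart Q q != 0.
  apply/eqP => /(congr1 (mcoeff c)); rewrite mcoeff_part /Q eqxx mcoeff0.
  by apply/eqP; rewrite -mcoeff_msupp.
have inpart B r m : m \in msupp (mpart B r) -> B m /\ m \in msupp r.
  by rewrite !mcoeff_msupp mcoeff_part; case: (B m); rewrite ?eqxx.
pose m := mlead (mpart P p * mpart Q q).
have mpq0 : m \in msupp (mpart P p * mpart Q q) by rewrite mlead_supp ?mulf_neq0.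
have lm : lam m = lam a + lam c.
  have [k [l [/inpart[/eqP kP _] /inpart[/eqP lQ _] ->]]] := mem_msuppM mpq0.
  by rewrite lamD kP lQ.
rewrite -lm; apply: bpq; rewrite mcoeff_msupp.
rewrite [in X in X * _](mpart_split P p) [in X in _ * X](mpart_split Q q).
rewrite mulrDr mulrDl !mcoeffD.
have z1 : (mpart (predC P) p * mpart Q q)@_m = 0.
  apply: memN_msupp_eq0; apply/negP.
  move=> /mem_msuppM[k [l [/inpart[kP kp] /inpart[/eqP lQ _] mE]]].
  move: lm; rewrite mE lamD lQ => /addIr kE; by move: kP; rewrite /= /P kE eqxx.
have z2 r : (forall k, k \in msupp r -> k \in msupp p) ->
    (r * mpart (predC Q) q)@_m = 0.
  move=> rp; apply: memN_msupp_eq0; apply/negP.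
  move=> /mem_msuppM[k [l [/rp kp /inpart[lQ lq] mE]]].
  have := amin _ kp; have := cmin _ lq; move: lm lQ; rewrite mE lamD /= /Q.
  by clear; lia.
rewrite z1 mulrDl mcoeffD !z2 ?addr0 -?mcoeff_msupp //.
  by move=> k /inpart[].
by move=> k /inpart[].
Qed.

End Weight.

(** * Divisorial ideals and class group of a normal semigroup ring *)

Lemma fraction_quotient (D : idomainType) (x : {fraction D}) :
  exists p q : D, q != 0 /\ x = tofrac p / tofrac q.
Proof.
elim/quotW: x => r; exists \n_r, \d_r; rewrite denom_ratioP; split=> //.
apply: (canRL (mulfK _)); first by rewrite tofrac_eq0 denom_ratioP.
unlock tofrac; rewrite -[LHS]FracField.pi_mul; apply/eqmodP => /=.
rewrite FracField.equivfE /FracField.mulf !numden_Ratio ?mulf_neq0 ?oner_neq0 ?denom_ratioP //.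
by rewrite !mulr1 mulrC.
Qed.

Section IntFfun.
Variables (T : finType).
Implicit Types (c : {ffun T -> int}).

Lemma ffun_add c c' t : (c + c') t = c t + c' t.
Proof. by rewrite ffunE. Qed.

Lemma ffun_opp c t : (- c) t = - c t.
Proof. by rewrite ffunE. Qed.

Lemma ffun_zero t : (0 : {ffun T -> int}) t = 0.
Proof. by rewrite ffunE. Qed.

(** In contrast to [ffunE] alone, this leaves sums and opposites in the form that
    arithmetic tactics recognize. *)
Definition ffE := (ffun_add, ffun_opp, ffun_zero, ffunE).

End IntFfun.

(** The ring R is spanned by the monomials on which the forms [lam f] are
    nonnegative.  Two hypotheses say that these forms are those of the facets:
    the cone has, for every f, a lattice vector in the relative interior of the
    facet of f ([facet_pt]), and f takes the value 1 ([ord_prim]).  Lattice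
    vectors are differences of exponents, given by pairs w, and correspond to
    the Laurent monomials [mon w].  The field F stands for the field of fractions
    of the polynomial ring. *)
Section MonomialDivisors.
Variables (K : fieldType) (n : nat) (Phi : finType) (lam : Phi -> 'X_{1..n} -> int).
Local Notation S := {mpoly K[n]}.
Variables (F : fieldType) (iota : {rmorphism S -> F}).
Hypothesis iota_inj : injective iota.
Hypothesis frac_of : forall x : F, exists p q : S, q != 0 /\ x = iota p / iota q.
Local Notation "p %:F" := (iota p).
Local Notation "''Y_' a" := (iota (mpolyX K a)) (at level 8, a at level 2).
Implicit Types (p q : S) (x y z : F) (a b m : 'X_{1..n}) (f g : Phi).
Implicit Types (w : 'X_{1..n} * 'X_{1..n}).
Implicit Types (c : {ffun Phi -> int}).

Definition mon w : F := 'Y_(w.1) / 'Y_(w.2).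
Definition ord f w : int := lam f w.1 - lam f w.2.

(** The monomial fractional ideals: the Laurent polynomials whose order at the
    facet f is at least c f. *)
Definition order_ge c y := exists p a, y = p%:F / 'Y_a /\
  forall m, m \in msupp p -> forall f, c f <= lam f m - lam f a.

Definition scaled_ideal x c y := exists z, order_ge c z /\ y = x * z.

Lemma iota_eq p q : (p%:F == q%:F) = (p == q).
Proof. exact: inj_eq. Qed.

Lemma iota_eq0 p : (p%:F == 0) = (p == 0).
Proof. by rewrite -iota_eq rmorph0. Qed.

Hypothesis lamD : forall f a b, lam f (a + b)%MM = lam f a + lam f b.

Lemma lam0 f : lam f 0%MM = 0.
Proof. by have := lamD f 0%MM 0%MM; rewrite addm0; lia. Qed.

Lemma lamMn f a k : lam f (a *+ k)%MM = lam f a * k%:Z.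
Proof.
elim: k => [|k IH]; first by rewrite mulm0n lam0 mulr0.
by rewrite mulmS lamD IH; lia.
Qed.

Lemma Y_neq0 a : 'Y_a != 0.
Proof. by rewrite iota_eq0 -msupp_eq0 msuppX. Qed.

Lemma YD a b : 'Y_(a + b)%MM = 'Y_a * 'Y_b.
Proof. by rewrite mpolyXD rmorphM. Qed.

Definition addw w w' := ((w.1 + w'.1)%MM, (w.2 + w'.2)%MM).

Lemma monD w w' : mon (addw w w') = mon w * mon w'.
Proof. by rewrite /mon /= !YD invfM; ring. Qed.

Lemma ordD f w w' : ord f (addw w w') = ord f w + ord f w'.
Proof. by rewrite /ord /= !lamD; ring. Qed.

Lemma eq_fracX p q a b : p%:F / 'Y_a = q%:F / 'Y_b -> p * 'X_[b] = q * 'X_[a].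
Proof.
move/eqP; rewrite eqr_div ?Y_neq0 // -!rmorphM iota_eq => /eqP.
exact.
Qed.

(** Order conditions can be tested on any representation as a quotient by a
    monomial. *)
Lemma order_ge_frac c p a : order_ge c (p%:F / 'Y_a) <->
  forall m, m \in msupp p -> forall f, c f <= lam f m - lam f a.
Proof.
split=> [[q [b [/eq_fracX E cq]]]|cp]; last by exists p, a.
move=> m mp f.
have : (b + m)%MM \in msupp (p * 'X_[b]) by rewrite mcoeff_msupp mcoeffMX -mcoeff_msupp.
rewrite E => /mem_msuppM[m1 [m2 [m1q]]]; rewrite msuppX inE => /eqP -> /(congr1 (lam f)).
by rewrite !lamD; have := cq _ m1q f; lia.
Qed.

Lemma order_ge0 c : order_ge c 0.
Proof. by exists 0, 0%MM; rewrite rmorph0 mul0r; split=> // m; rewrite msupp0. Qed.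

Lemma order_geD c x y : order_ge c x -> order_ge c y -> order_ge c (x + y).
Proof.
move=> [p [a [-> cp]]] [q [b [-> cq]]].
rewrite addf_div ?Y_neq0 // -YD -!rmorphM -rmorphD; apply/order_ge_frac => m.
move/msuppD_le; rewrite mem_cat => /orP[] /mem_msuppM[m1 [m2 [m1p + ->]]] f;
  rewrite msuppX inE => /eqP ->; rewrite !lamD.
  by have := cp _ m1p f; lia.
by have := cq _ m1p f; lia.
Qed.

Lemma order_geM c c' x y : order_ge c x -> order_ge c' y -> order_ge (c + c') (x * y).
Proof.
move=> [p [a [-> cp]]] [q [b [-> cq]]].
rewrite mulf_div -YD -rmorphM; apply/order_ge_frac.
move=> m /mem_msuppM[m1 [m2 [m1p m2q ->]]] f.
by rewrite ffE !lamD opprD addrACA lerD ?cp ?cq.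
Qed.

Lemma order_ge_mon c w : order_ge c (mon w) <-> forall f, c f <= ord f w.
Proof.
rewrite order_ge_frac; split=> [H f|H m]; first by apply: H; rewrite msuppX inE.
by rewrite msuppX inE => /eqP ->.
Qed.

Lemma mon_neq0 w : mon w != 0.
Proof. by rewrite mulf_neq0 ?invr_neq0 ?Y_neq0. Qed.

Lemma order_ge_poly p : exists c, order_ge c p%:F.
Proof.
exists [ffun f => - \sum_(m <- msupp p) `|lam f m|].
have -> : p%:F = p%:F / 'Y_(0%MM) by rewrite mpolyX0 rmorph1 divr1.
apply/order_ge_frac => m mp f; rewrite ffE lam0 subr0 (bigD1_seq m) ?msupp_uniq //=.
by rewrite lerNl (le_trans (ler_norm _)) // normrN lerDl sumr_ge0.
Qed.

Lemma order_ge_le c c' x : (forall f, c' f <= c f) -> order_ge c x -> order_ge c' x.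
Proof.
move=> le_c [p [a [-> cp]]]; apply/order_ge_frac => m mp f.
exact: le_trans (le_c f) (cp m mp f).
Qed.

Variable R : F -> Prop.
Hypothesis R_supp : forall y, R y <->
  exists p, y = p%:F /\ forall m, m \in msupp p -> forall f, 0 <= lam f m.
Hypothesis lam_pos : forall a m, (forall f, lam f a <= lam f m) -> (a <= m)%MM.
Hypothesis facet_pt : forall f, exists w, ord f w = 0 /\ forall g, g != f -> 0 < ord g w.
Hypothesis ord_prim : forall f, exists w, ord f w = 1.

Lemma R_order_ge y : R y <-> order_ge 0 y.
Proof.
rewrite R_supp; split=> [[p [-> p0]]|[p [a [-> pa]]]].
  have -> : p%:F = p%:F / 'Y_(0%MM) by rewrite mpolyX0 rmorph1 divr1.
  by apply/order_ge_frac => m mp f; rewrite ffE lam0 subr0 p0.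
have am m : m \in msupp p -> (a <= m)%MM.
  by move=> mp; apply: lam_pos => f; have := pa _ mp f; rewrite ffE; lia.
exists (\sum_(m <- msupp p) p@_m *: 'X_[m - a]); split.
  apply: (canLR (mulfK (Y_neq0 a))); rewrite -rmorphM {1}(mpolyE p) mulr_suml; congr (_%:F).
  rewrite big_seq [RHS]big_seq; apply: eq_bigr => m mp.
  by rewrite -scalerAl -mpolyXD submK ?am.
move=> m /msupp_sum_le/flattenP[s /mapP[k]]; rewrite mem_filter /= => kp -> {s}.
move/msuppZ_le; rewrite msuppX inE => /eqP -> f.
have := lamD f (k - a)%MM a; rewrite submK ?am // => kE.
by have := pa _ kp f; rewrite ffE kE; lia.
Qed.

Lemma ordMn f w k : ord f ((w.1 *+ k)%MM, (w.2 *+ k)%MM) = ord f w * k%:Z.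
Proof. by rewrite /ord /= !lamMn; ring. Qed.

Lemma ord_opp f w : ord f (w.2, w.1) = - ord f w.
Proof. by rewrite /ord /= opprB. Qed.

(** The bounds c on the orders of the elements of P are the best possible ones,
    and are attained by Laurent monomials in P. *)
Definition attains (P : F -> Prop) c :=
  [/\ forall y, P y -> order_ge c y, exists w, P (mon w) &
     forall f, exists w, P (mon w) /\ ord f w = c f].

Lemma ord_surj f (k : int) : exists w, ord f w = k.
Proof.
have [w w1] := ord_prim f; case: k => k.
  by exists ((w.1 *+ k)%MM, (w.2 *+ k)%MM); rewrite ordMn w1 mul1r.
exists ((w.2 *+ k.+1)%MM, (w.1 *+ k.+1)%MM).
by rewrite (ord_opp f ((w.1 *+ k.+1)%MM, _)) ordMn w1 mul1r NegzE.
Qed.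

(** Starting from a lattice vector with the prescribed value at f, a large
    multiple of a point in the interior of the facet f raises the values at the
    other facets and keeps the one at f. *)
Lemma attains_order_ge c : attains (order_ge c) c.
Proof.
have H f : exists w, order_ge c (mon w) /\ ord f w = c f.
  have [w0 w0f] := ord_surj f (c f); have [w1 [w1f w1g]] := facet_pt f.
  pose k := (\sum_g `|c g - ord g w0|)%N.
  exists (addw w0 ((w1.1 *+ k)%MM, (w1.2 *+ k)%MM)).
  split; last by rewrite ordD ordMn w1f w0f; lia.
  apply/order_ge_mon => g; rewrite ordD ordMn.
  have [->|/w1g] := eqVneq g f; first by rewrite w0f w1f; lia.
  have : (`|c g - ord g w0| <= k)%N by rewrite /k (bigD1 g) //= leq_addr.
  by nia.
split=> //; case: (pickP Phi) => [f _|Phi0]; first by have [w [? _]] := H f; exists w.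
by exists (0%MM, 0%MM); apply/order_ge_mon => f; have := Phi0 f.
Qed.

Lemma frac_mon p a w : p%:F / 'Y_a * mon w = (p * 'X_[w.1])%:F / 'Y_((a + w.2)%MM).
Proof. by rewrite /mon mulf_div rmorphM YD. Qed.

(** Multiplication by a Laurent monomial of P shows that z is a Laurent
    polynomial; the monomials of P of minimal order at f bound its order at f. *)
Lemma order_ge_transporter P c d z :
  attains P c -> (forall x, P x -> order_ge d (z * x)) -> order_ge (d - c) z.
Proof.
move=> [_ [w Pw] Pex] zP.
have [p [a zE]] : exists p a, z = p%:F / 'Y_a.
  have [q [b [E _]]] := zP _ Pw; exists (q * 'X_[w.2]), (b + w.1)%MM.
  rewrite -(frac_mon q b (w.2, w.1)) -E -mulrA -monD /mon /addw /= addmC divff ?mulr1 //.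
  exact: Y_neq0.
rewrite {}zE in zP *; apply/order_ge_frac => m mp f.
have [w' [Pw' w'f]] := Pex f; have := zP _ Pw'.
rewrite frac_mon => /order_ge_frac/(_ (w'.1 + m)%MM _ f); rewrite !ffE -w'f /ord !lamD.
by rewrite mcoeff_msupp mcoeffMX -mcoeff_msupp => /(_ mp); lia.
Qed.

Lemma colon_attains P c : attains P c -> colon R P = order_ge (- c).
Proof.
move=> fP; apply: pred_ext => y; split=> [yR|yc x Px].
  by rewrite -sub0r; apply: (order_ge_transporter fP) => x /yR/R_order_ge.
by case: fP => [/(_ _ Px) cx _ _]; apply/R_order_ge; rewrite -(addNr c); apply: order_geM.
Qed.

Lemma scaled_ideal1 c : scaled_ideal 1 c = order_ge c.
Proof.
apply: pred_ext => y; split=> [[z [cz ->]]|cy]; first by rewrite mul1r.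
by exists y; rewrite mul1r.
Qed.

Lemma scaled_idealE x c y : x != 0 -> scaled_ideal x c y <-> order_ge c (x^-1 * y).
Proof.
move=> xnz; split=> [[z [cz ->]]|cy]; first by rewrite mulKf.
by exists (x^-1 * y); rewrite mulVKf.
Qed.

Lemma colon_scaled x P c : x != 0 -> attains (fun z => P (x * z)) c ->
  colon R P = scaled_ideal x^-1 (- c).
Proof.
move=> xnz /colon_attains fP; apply: pred_ext => y.
rewrite scaled_idealE ?invr_neq0 // invrK -fP; split=> [yR z /yR|yR z Pz].
  by rewrite mulrCA mulrA.
by have := yR (x^-1 * z); rewrite mulVKf // => /(_ Pz); rewrite mulrACA divff // mul1r.
Qed.

Lemma colon_scaled_ideal x c :
  x != 0 -> colon R (scaled_ideal x c) = scaled_ideal x^-1 (- c).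
Proof.
move=> xnz; apply: colon_scaled => //.
rewrite (_ : (fun z => _) = order_ge c); first exact: attains_order_ge.
by apply: pred_ext => z; rewrite scaled_idealE // mulKf.
Qed.

Lemma colon2_scaled_ideal x c :
  x != 0 -> colon R (colon R (scaled_ideal x c)) = scaled_ideal x c.
Proof. by move=> xnz; rewrite !colon_scaled_ideal ?invr_neq0 // invrK opprK. Qed.

Lemma divisorial_scaled_ideal x c : x != 0 -> divisorial R (scaled_ideal x c).
Proof.
move=> xnz; split; last by rewrite colon2_scaled_ideal.
split.
- by exists 0; split; [exact: order_ge0|rewrite mulr0].
- move=> _ _ [y [cy ->]] [z [cz ->]]; exists (y + z); rewrite mulrDr.
  by split=> //; apply: order_geD.
- move=> r _ /R_order_ge r0 [y [cy ->]]; exists (r * y); rewrite mulrCA; split=> //.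
  by rewrite -[c]add0r; apply: order_geM.
- have [_ [w cw] _] := attains_order_ge c; exists (x * mon w).
  by rewrite mulf_neq0 ?mon_neq0 //; split=> //; exists (mon w).
have [p [q [qnz xE]]] := frac_of x.
have [cp Hp] := order_ge_poly p; have [cq Hq] := order_ge_poly q.
(* For x = p / q the denominator is q times a monomial of large orders *)
have [_ [w cw] _] := attains_order_ge [ffun f => `|cp f| + `|cq f| + `|c f|].
exists (mon w * q%:F); split.
- apply/R_order_ge; apply: order_ge_le (order_geM cw Hq) => f; rewrite !ffE; lia.
- by rewrite mulf_neq0 ?mon_neq0 ?iota_eq0.
move=> _ [y [cy ->]]; apply/R_order_ge.
have -> : mon w * q%:F * (x * y) = mon w * p%:F * y.
  by rewrite xE; field; rewrite iota_eq0.
by apply: order_ge_le (order_geM (order_geM cw Hp) cy) => f; rewrite !ffE; lia.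
Qed.

Lemma div_mul_scaled_ideal x c x' c' : x != 0 -> x' != 0 ->
  div_mul R (scaled_ideal x c) (scaled_ideal x' c') = scaled_ideal (x * x') (c + c').
Proof.
move=> xnz x'nz; have xx'nz : x * x' != 0 by rewrite mulf_neq0.
suff fP :
  attains (fun z => ideal_mul (scaled_ideal x c) (scaled_ideal x' c') (x * x' * z)) (c + c').
  rewrite /div_mul (colon_scaled xx'nz fP) colon_scaled_ideal ?invr_neq0 //.
  by rewrite invrK opprK.
have mem w w' : order_ge c (mon w) -> order_ge c' (mon w') ->
    ideal_mul (scaled_ideal x c) (scaled_ideal x' c') (x * x' * mon (addw w w')).
  move=> cw cw'; exists [:: (x * mon w, x' * mon w')]; split.
    by move=> _ /[!inE] /eqP ->; split; [exists (mon w)|exists (mon w')].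
  by rewrite big_seq1 /= monD mulrACA.
have [_ [w cw] Hc] := attains_order_ge c; have [_ [w' cw'] Hc'] := attains_order_ge c'.
split.
- move=> y [s [sP E]].
  suff [z [cz]] : exists z, order_ge (c + c') z /\ \sum_(p <- s) p.1 * p.2 = x * x' * z.
    by rewrite -E => /(mulfI xx'nz) ->.
  elim: s sP {E} => [|[u v] s IH] sP.
    by exists 0; rewrite big_nil mulr0; split=> //; apply: order_ge0.
  have [|z [cz E]] := IH; first by move=> p ps; apply: sP; rewrite inE ps orbT.
  have [[u' [cu /= uE]] [v' [cv /= vE]]] := sP (u, v) (mem_head _ _).
  exists (u' * v' + z); rewrite big_cons /= E uE vE mulrDr mulrACA; split=> //.
  by apply: order_geD => //; apply: order_geM.
- by exists (addw w w'); apply: mem.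
move=> f; have [v [cv vE]] := Hc f; have [v' [cv' v'E]] := Hc' f.
by exists (addw v v'); split; [apply: mem|rewrite ordD vE v'E ffE].
Qed.

(** If z carries one monomial ideal onto another, the orders of z and of z^-1
    are bounded by opposite vectors; as z z^-1 = 1, both have a monomial for
    which these bounds are equalities. *)
Lemma same_class_scaled_ideal x c x' c' : x != 0 -> x' != 0 ->
  same_class (scaled_ideal x c) (scaled_ideal x' c') <->
    exists w, forall f, c f - c' f = ord f w.
Proof.
move=> xnz x'nz; split=> [[y [ynz yP]]|[w wE]]; last first.
  have scale_quot (u v : F) : x / x' * u * (x' * v) = x * (u * v) by field.
  exists (x / x' * mon w); split=> [|z].
    exact: mulf_neq0 (mulf_neq0 xnz (invr_neq0 x'nz)) (mon_neq0 w).
  have ww' : mon w * mon (w.2, w.1) = 1.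
    rewrite /mon /= mulf_div [X in _ / X]mulrC divff //.
    by apply: mulf_neq0; apply: Y_neq0.
  have cw : order_ge (c - c') (mon w) by apply/order_ge_mon => f; rewrite !ffE wE.
  have cw' : order_ge (c' - c) (mon (w.2, w.1)).
    by apply/order_ge_mon => f; rewrite ord_opp -wE !ffE opprB.
  split=> [[u [cu ->]]|[_ [[u [cu ->]] ->]]].
    exists (x' * (mon (w.2, w.1) * u)); split.
      exists (mon (w.2, w.1) * u); split=> //.
      by have := order_geM cw' cu; rewrite subrK.
    by rewrite scale_quot [mon w * _]mulrA ww' mul1r.
  exists (mon w * u); split; last by rewrite scale_quot.
  by have := order_geM cw cu; rewrite subrK.
pose z := x^-1 * y * x'; have znz : z != 0 by rewrite !mulf_neq0 ?invr_neq0.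
have zc : order_ge (c - c') z.
  apply: (order_ge_transporter (attains_order_ge c')) => u c'u.
  have [|v [cv vE]] := (yP (y * (x' * u))).2 _.
    by exists (x' * u); split=> //; exists u.
  by rewrite /z -!mulrA vE mulKf.
have zc' : order_ge (c' - c) z^-1.
  apply: (order_ge_transporter (attains_order_ge c)) => u cu.
  have [|_ [[v [c'v ->]] uE]] := (yP (x * u)).1 _; first by exists u.
  suff -> : z^-1 * u = v by [].
  apply: (mulfI znz); rewrite mulVKf //; apply: (mulfI xnz).
  by rewrite uE /z; field.
move: zc zc' => [p [a [zE cp]]] [q [b [zVE cq]]].
have pq : p * q = 'X_[a + b].
  apply/eqP; rewrite -iota_eq YD rmorphM; apply/eqP.
  have : (p%:F / 'Y_a) * (q%:F / 'Y_b) = 1 by rewrite -zE -zVE divff.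
  rewrite mulf_div => /(canRL (mulfVK _)) -> //; first by rewrite mul1r.
  by apply: mulf_neq0; apply: Y_neq0.
have : (a + b)%MM \in msupp (p * q) by rewrite pq msuppX inE.
move=> /mem_msuppM[m [m' [mp m'q abE]]].
exists (m, a) => f; have := cp _ mp f; have := cq _ m'q f; rewrite !ffE /ord /=.
have := congr1 (lam f) abE; rewrite !lamD; lia.
Qed.

(** Let g be a gcd of d I in the polynomial ring, where d is a denominator of I,
    and put x0 = g / d.  The elements of x0^-1 I are polynomials without common
    divisor, so that y x0^-1 I in R forces y to be a polynomial.  With c the
    vector of least orders in x0^-1 I, additivity of the orders gives
    (R : x0^-1 I) = (order at least - c), and a second colon gives I. *)
Lemma divisorial_principal I : divisorial R I -> exists x c, x != 0 /\ I = scaled_ideal x c.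
Proof.
move=> [[I0 ID IM [x1 [x1nz Ix1]] [d [dR dnz dI]]] Icc].
pose T p := I (p%:F / d).
have Tex : exists p, T p /\ p != 0.
  have /R_supp[p [pE _]] := dI _ Ix1; exists p; split.
    by rewrite /T -pE mulrC mulKf.
  by rewrite -iota_eq0 -pE mulf_neq0.
have [g [gnz gP]] := @mpoly_set_gcd K n T Tex.
have gF : g%:F != 0 by rewrite iota_eq0.
pose x0 := g%:F / d; have x0nz : x0 != 0 by rewrite mulf_neq0 ?invr_neq0.
pose T' p := T (p * g).
have TE p : T p -> exists q, p = q * g.
  by move=> Tp; apply: set_gcd_dvd gP Tp.
have IT' z : I (x0 * z) <-> exists p, z = p%:F /\ T' p.
  split=> [Iz|[p [-> ]]]; last first.
    by have -> : x0 * p%:F = (p * g)%:F / d by rewrite rmorphM /x0 mulrC mulrA.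
  have /R_supp[p [pE _]] := dI _ Iz; have Tp : T p by rewrite /T -pE mulrC mulKf.
  have [q qE] := TE _ Tp; exists q; rewrite /T' -qE; split=> //.
  apply: (mulfI gF); by rewrite [RHS]mulrC -rmorphM -qE -pE /x0; field.
have [p1 [Tp1 p1nz]] := Tex; have [q1 q1E] := TE _ Tp1.
have T'q1 : T' q1 by rewrite /T' -q1E.
have q1nz : q1 != 0 by apply: contraNneq p1nz => q0; rewrite q1E q0 mul0r.
have lowP f : exists k : int, (forall p m, T' p -> m \in msupp p -> k <= lam f m) /\
    exists p m, [/\ T' p, m \in msupp p & k = lam f m].
  (* Multiplication by g leads into R, hence bounds the weights from below *)
  pose A k := exists p m, [/\ T' p, m \in msupp p & k = lam f m].
  pose b := lam f (mlead g).
  have Ab k : A k -> 0 <= k + b.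
    case=> p [m [T'p mp ->]]; apply: (weight_mul (lamD f) _ mp (mlead_supp gnz)).
    move=> k' pg; have := dI _ T'p; rewrite mulrC divfK // => /R_supp[r [/eqP]].
    by rewrite iota_eq => /eqP <-; apply.
  have [|k [Ak kmin]] := @ex_min_measure _ A (fun k => absz (k + b)).
    by exists (lam f (mlead q1)), q1, (mlead q1); rewrite mlead_supp.
  exists k; split=> // p m T'p mp.
  have Am : A (lam f m) by exists p, m.
  have := kmin _ Am; have := Ab _ Am; have := Ab _ Ak; lia.
have [k kP] := fin_all_exists lowP; pose c := [ffun f => k f].
have colI : colon R (fun z => I (x0 * z)) = order_ge (- c).
  apply: pred_ext => y; split=> [yI|yc z /IT'[p [-> T'p]]]; last first.
    apply/R_order_ge; rewrite -(addNr c); apply: order_geM => //.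
    have -> : p%:F = p%:F / 'Y_(0%MM) by rewrite mpolyX0 rmorph1 divr1.
    by apply/order_ge_frac => m mp f; rewrite ffE lam0 subr0; apply: (kP f).1 mp.
  have yT' p : T' p -> R (y * p%:F) by move=> T'p; apply: yI; apply/IT'; exists p.
  have [u [v [vnz yE]]] := frac_of y.
  have vF : v%:F != 0 by rewrite iota_eq0.
  have [s sE] : divides v u.
    apply: (divides_mul2l gnz); rewrite [g * u]mulrC; apply/gP => p Tp.
    have [q qE] := TE _ Tp; have /yT'/R_supp[r [rE _]] : T' q by rewrite /T' -qE.
    exists r; rewrite qE; apply/eqP; rewrite -iota_eq !rmorphM -rE yE; apply/eqP.
    by field.
  have {yE}yE : y = s%:F by rewrite yE sE rmorphM mulfK.
  have -> : y = s%:F / 'Y_(0%MM) by rewrite mpolyX0 rmorph1 divr1.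
  apply/order_ge_frac => m ms f; rewrite !ffE lam0 subr0.
  have [_ [p [m' [T'p m'p kE]]]] := kP f; rewrite kE.
  have : 0 <= lam f m + lam f m'.
    apply: (weight_mul (lamD f) _ ms m'p) => l lsp.
    have /R_supp[r [/eqP]] := yT' _ T'p; rewrite yE -rmorphM iota_eq => /eqP rE.
    by apply; rewrite -rE.
  by rewrite -[_ <= lam f m]subr_ge0 opprK.
exists x0, c; split=> //; apply: pred_ext => y; rewrite -Icc.
suff -> : colon R I = scaled_ideal x0^-1 (- c).
  by rewrite colon_scaled_ideal ?invr_neq0 // invrK opprK.
apply: pred_ext => z; rewrite scaled_idealE ?invr_neq0 // invrK -colI; split=> zI t It.
  by rewrite -mulrA mulrCA; apply: zI.
have := zI (x0^-1 * t); rewrite mulVKf // => /(_ It).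
by rewrite mulrACA divff // mul1r.
Qed.

(** Every divisorial ideal is x times a monomial ideal of some orders c; the
    vector c is determined up to the orders of a monomial by the class, and it
    is additive under multiplication. *)
Theorem Cl_isogP (G : zmodType) : Cl_isog R G <->
  exists psi : {ffun Phi -> int} -> G,
    [/\ forall c c', psi (c + c') = psi c + psi c', forall g : G, exists c, psi c = g
      & forall c, psi c = 0 <-> exists w, forall f, c f = ord f w].
Proof.
split=> [[cl [clM cl_surj clP]]|[psi [psiD psi_surj psi_ker]]].
  have dDv c : divisorial R (order_ge c).
    by rewrite -scaled_ideal1; apply: divisorial_scaled_ideal; apply: oner_neq0.
  have psiD c c' : cl (order_ge (c + c')) = cl (order_ge c) + cl (order_ge c').
    by rewrite -clM // -!scaled_ideal1 div_mul_scaled_ideal ?oner_neq0 // mulr1.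
  exists (fun c => cl (order_ge c)); split=> // [g|c].
    have [I [dI <-]] := cl_surj g; have [x [c [xnz E]]] := divisorial_principal dI.
    exists c; rewrite {}E; apply/clP => //; first exact: divisorial_scaled_ideal.
    rewrite -scaled_ideal1; apply/same_class_scaled_ideal; rewrite ?oner_neq0 //.
    by exists (0%MM, 0%MM) => f; rewrite /ord !subrr.
  have <- : cl (order_ge 0) = 0 by apply: (addrI (cl (order_ge 0))); rewrite -psiD !addr0.
  rewrite clP // -!scaled_ideal1 same_class_scaled_ideal ?oner_neq0 //.
  by split=> -[w wE]; exists w => f; have := wE f; rewrite ffE subr0.
pose Q (I : F -> Prop) (g : G) := exists x c, [/\ x != 0, I = scaled_ideal x c & g = psi c].
pose cl (I : F -> Prop) := epsilon (inhabits 0) (Q I).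
have psi0 : psi 0 = 0 by apply: (addrI (psi 0)); rewrite -psiD !addr0.
have psiN c : psi (- c) = - psi c by apply: (addrI (psi c)); rewrite -psiD !subrr.
have psi_eq c c' : psi c = psi c' <-> exists w, forall f, c f - c' f = ord f w.
  have -> : (psi c = psi c') <-> (psi (c - c') = 0).
    by rewrite psiD psiN; split=> [->|/subr0_eq//]; rewrite subrr.
  by rewrite psi_ker; split=> -[w wE]; exists w => f; have := wE f; rewrite !ffE.
have clE x c : x != 0 -> cl (scaled_ideal x c) = psi c.
  move=> xnz; have : Q (scaled_ideal x c) (cl (scaled_ideal x c)).
    by apply: epsilon_spec; exists (psi c), x, c.
  case=> x' [c' [x'nz E ->]]; apply/psi_eq/(@same_class_scaled_ideal x' c' x c) => //.
  by rewrite E; exists 1; rewrite oner_neq0; split=> // y; split=> [yI|[z [zI ->]]];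
    [exists y; rewrite mul1r|rewrite mul1r].
exists cl; split=> [I J dI dJ|g|I J dI dJ].
- have [x [c [xnz ->]]] := divisorial_principal dI.
  have [x' [c' [x'nz ->]]] := divisorial_principal dJ.
  by rewrite div_mul_scaled_ideal // !clE ?mulf_neq0 // psiD.
- have [c <-] := psi_surj g; exists (scaled_ideal 1 c).
  rewrite clE ?oner_neq0 //; split=> //.
  by apply: divisorial_scaled_ideal; apply: oner_neq0.
have [x [c [xnz ->]]] := divisorial_principal dI.
have [x' [c' [x'nz ->]]] := divisorial_principal dJ.
by rewrite !clE // psi_eq same_class_scaled_ideal.
Qed.

End MonomialDivisors.

(** * Hall's marriage theorem *)

Section Hall.
Variables U V : finType.
Implicit Types (N : U -> {set V}) (X : {set U}).

Definition hall N := [forall X : {set U}, #|X| <= #|\bigcup_(u in X) N u|]%N.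

(** Rado's argument: if N u contains two elements v1, v2, one of them can be
    removed without violating Hall's condition.  Otherwise there are sets X1, X2
    containing u that violate it after the removals, and submodularity of the
    size of the neighbourhood contradicts Hall's condition for the union of X1
    and X2 and for their intersection without u. *)
Lemma hall_marriage N : hall N -> exists f : U -> V, injective f /\ forall u, f u \in N u.
Proof.
have [k] := ubnP (\sum_u #|N u|)%N; elim: k N => // k IH N lt_k /forallP hN.
have N1 u : (0 < #|N u|)%N by have := hN [set u]; rewrite cards1 big_set1.
have [/existsP[u /card_gt1P[v1 [v2 [v1N v2N v12]]]]|/existsPn small] :=
    boolP [exists u, 1 < #|N u|]%N; last first.
  have sing u : exists v, N u = [set v].
    by apply/cards1P; rewrite eqn_leq N1 andbT leqNgt small.
  have [f fE] := fin_all_exists sing; exists f; split=> [u u' fuu'|u]; last first.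
    by rewrite fE set11.
  apply/eqP/negPn/negP => uu'; have := hN [set u; u'].
  by rewrite cards2 uu' bigcup_setU !big_set1 !fE fuu' setUid cards1.
pose N' v w := if w == u then N u :\ v else N w.
have N'sub v w : N' v w \subset N w.
  by rewrite /N'; case: eqP => [->|_]; rewrite ?subD1set.
have step v : v \in N u -> hall (N' v) ->
    exists f : U -> V, injective f /\ forall u, f u \in N u.
  move=> vN hN'; have [|f [fi fN]] := IH (N' v) _ hN'.
    rewrite -ltnS; apply: leq_trans lt_k; rewrite ltnS (bigD1 u) //= [ltnRHS](bigD1 u) //=.
    rewrite -addSn leq_add //; first by rewrite /N' eqxx [leqRHS](cardsD1 v) vN.
    by apply: leq_sum => w _; apply: subset_leq_card.
  by exists f; split=> // w; apply: subsetP (N'sub v w) _ (fN w).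
have [/(step _ v1N)//|/forallPn[X1 lt1]] := boolP (hall (N' v1)).
have [/(step _ v2N)//|/forallPn[X2 lt2]] := boolP (hall (N' v2)).
have inX v X : ~~ (#|X| <= #|\bigcup_(w in X) N' v w|)%N -> u \in X.
  apply: contraR => uX; rewrite (eq_bigr N) ?hN // => w wX.
  by rewrite /N'; case: eqP wX uX => // -> ->.
have u1 := inX _ _ lt1; have u2 := inX _ _ lt2; rewrite -!ltnNge in lt1 lt2.
set B1 := \bigcup_(w in X1) _ in lt1; set B2 := \bigcup_(w in X2) _ in lt2.
have leU : (#|X1 :|: X2| <= #|B1 :|: B2|)%N.
  apply: leq_trans (hN _) (subset_leq_card _); apply/bigcupsP => w wX.
  have [->|wu] := eqVneq w u.
    apply/subsetP => v vN; rewrite inE; have [vv1|vv1] := eqVneq v v1.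
      apply/orP; right; apply/bigcupP; exists u => //.
      by rewrite /N' eqxx !inE vN vv1 v12.
    by apply/orP; left; apply/bigcupP; exists u => //; rewrite /N' eqxx !inE vv1.
  have NE v : N w = N' v w by rewrite /N' (negPf wu).
  case/setUP: wX => wX; apply/subsetP => v vN; rewrite inE; apply/orP.
    by left; apply/bigcupP; exists w; rewrite // -NE.
  by right; apply/bigcupP; exists w; rewrite // -NE.
have leI : (#|(X1 :&: X2) :\ u| <= #|B1 :&: B2|)%N.
  apply: leq_trans (hN _) (subset_leq_card _); apply/bigcupsP => w.
  rewrite !inE => /and3P[wu w1 w2].
  have NE v : N w = N' v w by rewrite /N' (negPf wu).
  apply/subsetP => v vN; rewrite inE; apply/andP; split; apply/bigcupP.
    by exists w; rewrite // -NE.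
  by exists w; rewrite // -NE.
have := cardsUI X1 X2; have := cardsUI B1 B2.
have := cardsD1 u (X1 :&: X2); rewrite inE u1 u2 /=.
by move: lt1 lt2 leU leI; lia.
Qed.

End Hall.

(** * The toric ring as a semigroup ring *)

Lemma sum_nat_of_bool (T : finType) (P : pred T) :
  (\sum_x (P x : nat) = #|[set x | P x]|)%N.
Proof. by rewrite -sum1dep_card [RHS]big_mkcond; apply: eq_bigr => x _; case: (P x). Qed.

Section ToricRing.
Variables (n s : nat) (A : 'I_s -> {set 'I_n}).
Hypothesis A_neq0 : forall k, A k != set0.
Implicit Types (X Y Z : {set 'I_n}) (i j : 'I_n) (k l : 'I_s).
Local Notation widen := (widen_ord (leqnSn n)).

Definition blocks_of i : {set 'I_s} := [set k | i \in A k].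
Definition blocks X : {set 'I_s} := \bigcup_(i in X) blocks_of i.
Definition rk X := #|blocks X|.

Lemma blocksP X k : reflect (exists2 i, i \in X & i \in A k) (k \in blocks X).
Proof.
apply: (iffP bigcupP) => [[i iX]|[i iX iA]]; first by rewrite inE; exists i.
by exists i; rewrite ?inE.
Qed.

(** Integer decomposition: match the u i copies of each i with q copies of the
    blocks.  Hall's condition for a set of copies follows from the inequality of
    the set X of their elements, and the copies that are matched with the h-th
    copies of the blocks form a vector of the polymatroid. *)
Lemma transversal_decomposition (u : 'I_n -> nat) (q : nat) :
  (forall X, \sum_(i in X) u i <= q * rk X)%N ->
  exists v : 'I_q -> 'X_{1..n}, (forall h, transversal_polymatroid A (v h)) /\
    forall i, u i = (\sum_h v h i)%N.
Proof.
move=> uX.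
pose tg i (j : 'I_(u i)) : {i : 'I_n & 'I_(u i)} := Tagged (fun i => 'I_(u i)) j.
pose N (x : {i & 'I_(u i)}) := [set p : 'I_s * 'I_q | tag x \in A p.1].
have [|f [finj fN]] := @hall_marriage _ _ N.
  apply/forallP => W; pose X := [set tag x | x in W].
  have leW : (#|W| <= \sum_(i in X) u i)%N.
    rewrite (eq_bigr (fun i => \sum_(j : 'I_(u i)) 1)%N); last first.
      by move=> i _; rewrite sum1_card card_ord.
    rewrite (sig_big_dep (mem X) (fun=> xpredT) (fun _ _ => 1%N)) /= sum1_card.
    apply: subset_leq_card.
    by apply/subsetP => x xW; rewrite unfold_in andbT; apply/imsetP; exists x.
  apply: leq_trans leW (leq_trans (uX X) _).
  rewrite -[q in (q * _)%N]card_ord -cardsT mulnC -cardsX; apply: subset_leq_card.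
  apply/subsetP => -[k h]; rewrite !inE andbT => /blocksP[i /imsetP[x xW ->] iA].
  by apply/bigcupP; exists x; rewrite // inE.
exists (fun h => [multinom #|[set j : 'I_(u i) | (f (tg i j)).2 == h]| | i < n]).
split=> [h|i]; last first.
  under eq_bigr do rewrite mnmE -sum1dep_card.
  rewrite -[LHS]card_ord -sum1_card.
  by rewrite (partition_big (fun j : 'I_(u i) => (f (tg i j)).2) predT).
have [a aA] := fin_all_exists (fun k => set0Pn _ (A_neq0 k)).
(* Blocks whose h-th copy is not matched choose an arbitrary element *)
pose t k := if [pick x | f x == (k, h)] is Some x then tag x else a k.
exists t; split=> [k|].
  by rewrite /t; case: pickP => // x /eqP fx; have := fN x; rewrite inE fx.
apply/mnm_lepP => i; rewrite mnmE mnm_sumE; under eq_bigr do rewrite mnm1E.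
rewrite sum_nat_of_bool.
pose g (j : 'I_(u i)) := (f (tg i j)).1.
rewrite -(card_in_imset (f := g)); last first.
  move=> j j'; rewrite !inE => /eqP jh /eqP j'h gg.
  have : f (tg i j) = f (tg i j').
    by rewrite [LHS]surjective_pairing [RHS]surjective_pairing jh j'h; congr (_, _).
  by move/finj/eqP; rewrite /tg eq_Tagged => /eqP.
apply: subset_leq_card; apply/subsetP => k /imsetP[j]; rewrite inE => /eqP jh ->.
rewrite inE /t; case: pickP => [x /eqP fx|/(_ (tg i j))]; last first.
  by rewrite [f _]surjective_pairing jh eqxx.
have : f x = f (tg i j) by rewrite fx [RHS]surjective_pairing jh.
by move/finj => ->.
Qed.

(** The exponent of x^v t. *)
Definition xt (v : 'X_{1..n}) : 'X_{1..n.+1} := (mnmwiden v + U_(ord_max))%MM.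

Lemma xt_widen v i : xt v (widen i) = v i.
Proof. by rewrite mnmDE mnmwiden_widen mnm1E -val_eqE /= gtn_eqF ?addn0. Qed.

Lemma xt_max v : xt v ord_max = 1%N.
Proof. by rewrite mnmDE mnmwiden_ordmax mnm1E eqxx. Qed.

Lemma mnmP_widen (a b : 'X_{1..n.+1}) :
  (forall i, a (widen i) = b (widen i)) -> a ord_max = b ord_max -> a = b.
Proof.
move=> ab abm; apply/mnmP => i; have [j ->|->//] := unliftP ord_max i.
have -> : lift ord_max j = widen j by apply: val_inj; rewrite /= /bump leqNgt ltn_ord.
exact: ab.
Qed.

Lemma monomial_xtE (K : fieldType) v : monomial_xt K v = 'X_[xt v].
Proof.
rewrite /monomial_xt mpolyXD [X in _ = X * _]mpolyXE_id big_ord_recr /=.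
rewrite mnmwiden_ordmax expr0 mulr1.
by congr (_ * _); apply: eq_bigr => i _; rewrite mnmwiden_widen.
Qed.

Definition rank_bounded (w : 'X_{1..n.+1}) :=
  forall X, (\sum_(i in X) w (widen i) <= w ord_max * rk X)%N.

Lemma rank_boundedD a b : rank_bounded a -> rank_bounded b -> rank_bounded (a + b)%MM.
Proof.
move=> ra rb X; rewrite (eq_bigr (fun i => a (widen i) + b (widen i)))%N; last first.
  by move=> i _; rewrite mnmDE.
by rewrite big_split mnmDE mulnDl leq_add.
Qed.

Lemma rank_bounded_xt v : transversal_polymatroid A v -> rank_bounded (xt v).
Proof.
case=> t [tA /mnm_lepP tv] X; rewrite xt_max mul1n.
apply: (@leq_trans (\sum_(i in X) \sum_k (t k == i))%N).
  by apply: leq_sum => i _; rewrite xt_widen; have := tv i; rewrite mnm_sumE;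
    under eq_bigr do rewrite mnm1E.
rewrite exchange_big /=.
apply: (@leq_trans (\sum_k (t k \in X))%N).
  apply: leq_sum => k _; have [tX|tX] := boolP (t k \in X).
    by rewrite (bigD1 (t k)) //= eqxx big1 // => i /andP[_ /negPf]; rewrite eq_sym => ->.
  by rewrite big1 // => i iX; case: eqP => // E; rewrite E iX in tX.
rewrite sum_nat_of_bool; apply: subset_leq_card; apply/subsetP => k; rewrite inE => tX.
by apply/blocksP; exists (t k).
Qed.

Variable K : fieldType.

Lemma toric_ringP (p : {mpoly K[n.+1]}) :
  toric_ring A p <-> forall m, m \in msupp p -> rank_bounded m.
Proof.
split=> [|pm].
  elim=> [c|g [v [Pv ->]]|f g _ IHf _ IHg|f g _ IHf _ IHg] m.
  - rewrite alg_mpolyC msuppC; case: eqP => // _; rewrite inE => /eqP -> X.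
    by rewrite big1 // => i _; rewrite mnm0E.
  - by rewrite monomial_xtE msuppX inE => /eqP ->; apply: rank_bounded_xt.
  - by move/msuppD_le; rewrite mem_cat => /orP[/IHf|/IHg].
  by move/mem_msuppM => [a [b [/IHf ra /IHg rb ->]]]; apply: rank_boundedD.
rewrite (mpolyE p) big_seq; elim/big_ind: _ => [|f g pf pg|m /pm rm].
- by rewrite -(scale0r 1); apply: SubalgScalar.
- exact: SubalgAdd.
rewrite -mulr_algl; apply: SubalgMul; first exact: SubalgScalar.
have [v [Pv vE]] := transversal_decomposition rm.
have -> : 'X_[m] = \prod_(h < m ord_max) monomial_xt K (v h).
  under eq_bigr do rewrite monomial_xtE.
  rewrite mprodXE; congr 'X_[_]; apply: mnmP_widen => [i|].
    by rewrite vE mnm_sumE; apply: eq_bigr => h _; rewrite xt_widen.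
  by rewrite mnm_sumE; under eq_bigr do rewrite xt_max; rewrite sum1_card card_ord.
elim/big_ind: _ => [|f g|h _]; first by rewrite -(scale1r 1); apply: SubalgScalar.
  exact: SubalgMul.
by apply: SubalgGen; exists (v h).
Qed.

End ToricRing.

(** * The facets of the cone *)

Section Facets.
Variables (n s : nat) (A : 'I_s -> {set 'I_n}).
Hypothesis A_cover : \bigcup_(k < s) A k = [set: 'I_n].
Implicit Types (X Y Z : {set 'I_n}) (i j : 'I_n) (k l : 'I_s).
Local Notation widen := (widen_ord (leqnSn n)).

Lemma mem_some_block i : exists k, i \in A k.
Proof.
have : i \in \bigcup_(k < s) A k by rewrite A_cover inE.
by case/bigcupP => k _ iA; exists k.
Qed.

Lemma blocksS X Y : X \subset Y -> blocks A X \subset blocks A Y.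
Proof.
move/subsetP => XY; apply/subsetP => k /blocksP[i /XY iY iA].
by apply/blocksP; exists i.
Qed.

Lemma blocks1 i : blocks A [set i] = blocks_of A i.
Proof. by rewrite /blocks big_set1. Qed.

Lemma rk_gt0 X : X != set0 -> (0 < rk A X)%N.
Proof.
case/set0Pn => i iX; have [k iA] := mem_some_block i.
by apply/card_gt0P; exists k; apply/blocksP; exists i.
Qed.

(** Equivalently, the rank of X grows when any element outside X is added. *)
Definition rk_closed X := [forall i, (blocks_of A i \subset blocks A X) ==> (i \in X)].

(** Equivalently, the rank of X is smaller than the sum of the ranks of the parts
    of any partition of X into two nonempty sets. *)
Definition inseparable X := [forall Y : {set 'I_n},
  [&& Y \subset X, Y != set0 & Y != X] ==>
    ~~ [disjoint blocks A Y & blocks A (X :\: Y)]].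

Definition facet X := [&& X != set0, rk_closed X & inseparable X].

Definition closure X := [set i | blocks_of A i \subset blocks A X].

Lemma sub_closure X : X \subset closure X.
Proof.
apply/subsetP => i iX; rewrite inE -blocks1; apply: blocksS; by rewrite sub1set.
Qed.

Lemma blocks_closure X : blocks A (closure X) = blocks A X.
Proof.
apply/eqP; rewrite eqEsubset (blocksS (sub_closure X)) andbT.
apply/subsetP => k /blocksP[i]; rewrite inE => /subsetP/(_ k) + iA.
by apply; rewrite inE.
Qed.

Lemma inseparableP X Y : inseparable X -> Y \subset X -> Y != set0 -> Y != X ->
  exists k, k \in blocks A Y /\ k \in blocks A (X :\: Y).
Proof.
move=> /forallP/(_ Y)/implyP iX YX Y0 YneX; have := iX; rewrite YX Y0 YneX.
by move=> /(_ isT)/pred0Pn[k /andP[k1 k2]]; exists k.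
Qed.

(** A partition of the closure of X restricts to one of X; it stays nontrivial,
    because every element of the closure only lies in blocks that meet X. *)
Lemma facet_closure X : X != set0 -> inseparable X -> facet (closure X).
Proof.
move=> X0 iX; apply/and3P; split.
- by case/set0Pn: X0 => i iX0; apply/set0Pn; exists i; apply: (subsetP (sub_closure X)).
- by apply/forallP => i; apply/implyP; rewrite blocks_closure inE.
apply/forallP => Y; apply/implyP => /and3P[YX Y0 YneX]; apply/negP => dis.
have noboth k : k \in blocks A Y -> k \in blocks A (closure X :\: Y) -> False.
  by move=> k1 k2; have := disjointFr dis k1; rewrite k2.
have meet Z : Z \subset closure X -> Z != set0 ->
    exists k, k \in blocks A Z /\ k \in blocks A X.
  move=> ZX /set0Pn[i iZ]; have [k iA] := mem_some_block i; exists k.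
  have kZ : k \in blocks A Z by apply/blocksP; exists i.
  by split=> //; rewrite -blocks_closure; apply: subsetP (blocksS ZX) _ kZ.
have [E|E0] := eqVneq (Y :&: X) set0.
  have [k [kY kX]] := meet _ YX Y0; apply: (noboth _ kY).
  apply: subsetP kX; apply: blocksS; apply/subsetP => i iX'.
  rewrite inE (subsetP (sub_closure X)) // andbT.
  by apply/negP => iY; have := in_set0 i; rewrite -E inE iY iX'.
have [E|EX] := eqVneq (Y :&: X) X.
  have [k [kY kX]] : exists k, k \in blocks A (closure X :\: Y) /\ k \in blocks A X.
    apply: meet; first exact: subsetDl.
    by rewrite setD_eq0; apply: contraNN YneX => sub; rewrite eqEsubset YX.
  apply: (noboth k) => //; apply: subsetP kX; apply: blocksS.
  by rewrite -E subsetIl.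
have [k [k1 k2]] := inseparableP iX (subsetIr Y X) E0 EX.
apply: (noboth k).
  by apply: subsetP k1; apply: blocksS; apply: subsetIl.
apply: subsetP k2; apply: blocksS; apply/subsetP => i.
rewrite !inE => /andP[+ iX']; rewrite iX' andbT => -> /=.
by have := subsetP (sub_closure X) _ iX'; rewrite inE.
Qed.

Lemma inseparable1 i : inseparable [set i].
Proof.
apply/forallP => Y; apply/implyP => /and3P[]; rewrite subset1 => /orP[/eqP ->|/eqP ->].
  by rewrite eqxx.
by rewrite eqxx.
Qed.

Lemma facet_closure1 i : facet (closure [set i]).
Proof.
apply: facet_closure; last exact: inseparable1.
by apply/set0Pn; exists i; rewrite inE.
Qed.

(** The inequality of X follows from that of its closure if X is inseparable, and
    is the sum of the inequalities of two smaller sets otherwise. *)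
Lemma rank_bounded_facets (w : 'X_{1..n.+1}) :
  (forall X, facet X -> \sum_(i in X) w (widen i) <= w ord_max * rk A X)%N ->
  rank_bounded A w.
Proof.
move=> wF X; have [m] := ubnP #|X|; elim: m X => // m IH X ltX.
have [->|X0] := eqVneq X set0; first by rewrite big_set0.
have [iX|/forallPn[Y]] := boolP (inseparable X).
  rewrite /rk -blocks_closure; apply: leq_trans (wF _ (facet_closure X0 iX)).
  rewrite [leqRHS](big_setID X) /= (setIidPr (sub_closure X)); exact: leq_addr.
rewrite negb_imply negbK => /andP[/and3P[YX Y0 YneX] dis].
have XE : X = Y :|: (X :\: Y) by rewrite setDE setUIr setUCr setIT (setUidPr YX).
rewrite (big_setID Y) /= (setIidPr YX).
have -> : rk A X = (rk A Y + rk A (X :\: Y))%N.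
  rewrite /rk -(cardsUI (blocks A Y)).
  move: dis; rewrite -setI_eq0 => /eqP ->; rewrite cards0 addn0 -bigcup_setU -XE //.
have ltY : (#|Y| < #|X|)%N by rewrite proper_card // properEneq YneX.
rewrite mulnDr leq_add // IH ?(leq_trans ltY) //.
rewrite cardsD (setIidPr YX).
have : (0 < #|Y|)%N by rewrite card_gt0.
by move: ltX ltY; lia.
Qed.


(** Vectors on the facets are produced from partial choices of elements of the
    blocks: an assignment gives the vector (u, 1) with u_i the number of blocks
    that choose i, and the slack of the inequality of X is the number of blocks
    that meet X but do not choose an element of X. *)
Definition assignment (f : 'I_s -> option 'I_n) := forall k i, f k = Some i -> i \in A k.

Definition hits (f : 'I_s -> option 'I_n) X : {set 'I_s} :=
  [set k | if f k is Some i then i \in X else false].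

Lemma hits_sub f X : assignment f -> hits f X \subset blocks A X.
Proof.
move=> fA; apply/subsetP => k; rewrite inE; case E: (f k) => [i|//] iX.
by apply/blocksP; exists i => //; apply: fA.
Qed.

Definition assignment_point (f : 'I_s -> option 'I_n) : 'X_{1..n.+1} :=
  xt [multinom #|[set k | f k == Some i]| | i < n].

Lemma sum_point f X : (\sum_(i in X) assignment_point f (widen i) = #|hits f X|)%N.
Proof.
rewrite (eq_bigr (fun i => \sum_k (f k == Some i : nat)))%N; last first.
  by move=> i _; rewrite xt_widen mnmE sum_nat_of_bool.
rewrite exchange_big -sum_nat_of_bool /=; apply: eq_bigr => k _.
case: (f k) => [j|]; last by rewrite big1.
have [jX|jX] := boolP (j \in X).
  rewrite (bigD1 j) //= eqxx big1 // => i /andP[_ ij].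
  by case: eqP => // -[E]; rewrite E eqxx in ij.
by rewrite big1 // => i iX; case: eqP => // -[E]; rewrite E iX in jX.
Qed.

Definition form_index := ('I_n + {X | facet X})%type.

Definition facet_form (f : form_index) (w : 'X_{1..n.+1}) : int :=
  match f with
  | inl i => (w (widen i))%:Z
  | inr X => (w ord_max * rk A (val X))%N%:Z - (\sum_(i in val X) w (widen i))%N%:Z
  end.

Lemma facet_formD f a b : facet_form f (a + b)%MM = facet_form f a + facet_form f b.
Proof.
case: f => [i|X] /=; first by rewrite mnmDE PoszD.
rewrite (eq_bigr (fun i => a (widen i) + b (widen i)))%N; last first.
  by move=> i _; rewrite mnmDE.
by rewrite big_split mnmDE mulnDl !PoszD /=; lia.
Qed.

Lemma facet_form_ge0P w : (forall f, 0 <= facet_form f w) <-> rank_bounded A w.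
Proof.
split=> [w0|wb [i|X]] //=; last by rewrite subr_ge0 lez_nat.
apply: rank_bounded_facets => X fX.
by have := w0 (inr (exist _ X fX)); rewrite /= subr_ge0 lez_nat.
Qed.

Lemma facet_form_point (X : {X | facet X}) f :
  facet_form (inr X) (assignment_point f) = (rk A (val X))%:Z - #|hits f (val X)|%:Z.
Proof. by rewrite /= sum_point xt_max mul1n. Qed.

Lemma point_ge0 f g : assignment f -> 0 <= facet_form g (assignment_point f).
Proof.
move=> fA; case: g => [i //|X]; rewrite facet_form_point subr_ge0 lez_nat.
by apply: subset_leq_card; apply: hits_sub.
Qed.

Lemma point_pos i f k : f k = Some i -> 0 < facet_form (inl i) (assignment_point f).
Proof.
by move=> fk; rewrite /= xt_widen mnmE ltz_nat; apply/card_gt0P; exists k; rewrite inE fk.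
Qed.

Lemma point_slack (X : {X | facet X}) f k : assignment f ->
  k \in blocks A (val X) -> k \notin hits f (val X) ->
  0 < facet_form (inr X) (assignment_point f).
Proof.
move=> fA kX kh; rewrite facet_form_point subr_gt0 ltz_nat; apply: proper_card.
by apply/properP; split; [exact: hits_sub|exists k].
Qed.

Lemma point_tight (X : {X | facet X}) f : assignment f ->
  blocks A (val X) \subset hits f (val X) -> facet_form (inr X) (assignment_point f) = 0.
Proof.
move=> fA sub; rewrite facet_form_point; apply/eqP; rewrite subr_eq0 eqz_nat.
by rewrite eqn_leq !subset_leq_card ?hits_sub.
Qed.

Definition empty_assignment (k : 'I_s) : option 'I_n := None.

Lemma assignment_empty : assignment empty_assignment. Proof. by []. Qed.

Definition set_value (f : 'I_s -> option 'I_n) k i l := if l == k then Some i else f l.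

Lemma assignment_set f k i : assignment f -> i \in A k -> assignment (set_value f k i).
Proof.
by move=> fA iA l j; rewrite /set_value; case: eqP => [-> [<-]|_ /fA].
Qed.

Lemma tight_assignment X : exists f, [/\ assignment f, blocks A X \subset hits f X
  & forall k, k \notin blocks A X -> f k = None].
Proof.
exists (fun k => [pick i in X :&: A k]); split=> [k i||k kX].
- by case: pickP => // j + [<-]; rewrite inE => /andP[].
- apply/subsetP => k /blocksP[i iX iA]; rewrite inE; case: pickP => [j|/(_ i)].
    by rewrite inE => /andP[].
  by rewrite inE iX iA.
case: pickP => // i; rewrite inE => /andP[iX iA].
by case/negP: kX; apply/blocksP; exists i.
Qed.

Lemma tight_set f X k i : blocks A X \subset hits f X -> (k \in blocks A X -> i \in X) ->
  blocks A X \subset hits (set_value f k i) X.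
Proof.
move=> /subsetP fX kiX; apply/subsetP => l lX; rewrite inE /set_value.
by case: eqP => [E|_]; [apply: kiX; rewrite -E|have := fX _ lX; rewrite inE].
Qed.

(** The cone contains a vector on the facet of f but not on that of g.  For a
    set X, start from an assignment in which every block that meets X chooses an
    element of X and the others choose nothing.  It is changed in one block k:
    for g = u_j, the block k contains j; it is a block that does not meet X
    if j is not in X, which exists as X is closed.  For a set Y, either a block
    meets Y but not X, and no change is needed, or Y lies in X as X is closed,
    and as X is inseparable some block meets both Y and X - Y; this block k
    chooses an element of X - Y. *)
Lemma facet_separation f g : g != f -> exists a,
  [/\ facet_form f a = 0, 0 < facet_form g a & forall h, 0 <= facet_form h a].
Proof.
case: f => [i|X] gf.
  case: g gf => [j ji|Y _].
    have [k jA] := mem_some_block j; have fA := assignment_set assignment_empty jA.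
    exists (assignment_point (set_value empty_assignment k j)).
    split; last by move=> h; apply: point_ge0.
      rewrite /= xt_widen mnmE (_ : [set _ | _] = set0) ?cards0 //.
      apply/setP => l; rewrite !inE /set_value; case: (l == k) => //.
      by apply/negP => /eqP[E]; rewrite E eqxx in ji.
    by apply: (@point_pos _ _ k); rewrite /set_value eqxx.
  have Y0 : val Y != set0 by have /and3P[] := valP Y.
  have [k kY] := card_gt0P (rk_gt0 Y0).
  exists (assignment_point empty_assignment).
  split; last by move=> h; apply: point_ge0; apply: assignment_empty.
    by rewrite /= xt_widen mnmE (_ : [set _ | _] = set0) ?cards0.
  by apply: (point_slack (k := k)); rewrite ?inE //; apply: assignment_empty.
have /and3P[X0 /forallP clX iX] := valP X.
have [d [dA dX dN]] := tight_assignment (val X).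
case: g gf => [j _|Y YX].
  have [k [jA kj]] : exists k, j \in A k /\ (k \in blocks A (val X) -> j \in val X).
    have [jX|jX] := boolP (j \in val X); first by have [k jA] := mem_some_block j; exists k.
    have := clX j; rewrite (negPf jX) implybF => /subsetPn[k]; rewrite inE => jA /negPf kX.
    by exists k; rewrite kX.
  have fA := assignment_set dA jA; exists (assignment_point (set_value d k j)); split.
  - by apply: point_tight => //; apply: tight_set.
  - by apply: (@point_pos _ _ k); rewrite /set_value eqxx.
  by move=> h; apply: point_ge0.
have /and3P[Y0 /forallP clY iY] := valP Y.
have [YsX|/subsetPn[k kY kX]] := boolP (blocks A (val Y) \subset blocks A (val X)); last first.
  exists (assignment_point d); split; [exact: point_tight| |by move=> h; apply: point_ge0].
  by apply: (point_slack (k := k)) => //; rewrite inE (dN k).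
have sub : val Y \subset val X.
  apply/subsetP => i iY'; have /implyP := clX i; apply; apply: subset_trans YsX.
  by rewrite -blocks1; apply: blocksS; rewrite sub1set.
have neq : val Y != val X by apply: contraNneq YX => /val_inj ->.
have [k [kY /blocksP[i]]] := inseparableP iX sub Y0 neq.
rewrite inE => /andP[iY' iX'] iA; have fA := assignment_set dA iA.
exists (assignment_point (set_value d k i)); split; last by move=> h; apply: point_ge0.
  by apply: point_tight => //; apply: tight_set.
by apply: (point_slack (k := k)) => //; rewrite inE /set_value eqxx.
Qed.

End Facets.

(** * The class group of the toric ring *)

Section ClassGroup.
Variables (K : fieldType) (n s : nat) (A : 'I_s -> {set 'I_n}).
Hypothesis n_gt0 : (0 < n)%N.
Hypothesis A_neq0 : forall k, A k != set0.
Hypothesis A_cover : \bigcup_(k < s) A k = [set: 'I_n].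
Implicit Types (i : 'I_n) (G : zmodType).
Local Notation widen := (widen_ord (leqnSn n)).

Definition facets : finType := {X : {set 'I_n} | facet A X}.

Lemma facet_form_sum f (I : finType) (a : I -> 'X_{1..n.+1}) :
  @facet_form n s A f (\big[+%MM/0%MM]_j a j)%MM = \sum_j facet_form f (a j).
Proof.
apply: (big_morph (facet_form f)); first exact: facet_formD.
exact: (lam0 (@facet_formD n s A)).
Qed.

(** The sum over g of vectors on the facet of f that are not on that of g lies on
    no facet but that of f. *)
Lemma facet_interior f : exists w,
  ord (@facet_form n s A) f w = 0 /\ forall g, g != f -> 0 < ord (@facet_form n s A) g w.
Proof.
have ex g : exists a, [/\ @facet_form n s A f a = 0, g != f -> 0 < facet_form g a
    & forall h, 0 <= @facet_form n s A h a].
  have [_|/(facet_separation A_cover)[a [a0 ag ah]]] := eqVneq g f; last by exists a.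
  by exists 0%MM; split=> // [|h]; rewrite (lam0 (@facet_formD n s A)).
have [a aP] := fin_all_exists ex.
exists ((\big[+%MM/0%MM]_j a j)%MM, 0%MM); split=> [|g gf];
  rewrite /ord (lam0 (@facet_formD n s A)) subr0 /= facet_form_sum.
  by rewrite big1 // => g _; have [] := aP g.
have [_ /(_ gf) ag _] := aP g; rewrite (bigD1 g) //= ltr_wpDr //.
by apply: sumr_ge0 => j _; have [_ _] := aP j; apply.
Qed.

Lemma form_primitive f : exists w, ord (@facet_form n s A) f w = 1.
Proof.
case: f => [i|X].
  by exists (U_(widen i), 0)%MM; rewrite /ord /= mnm1E eqxx mnm0E.
have /and3P[/set0Pn[i iX] _ _] := valP X.
exists (0, U_(widen i))%MM; rewrite /ord /= !mnm0E mnm1E -val_eqE /= ltn_eqF //.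
rewrite big1 => [|j _]; last by rewrite mnm0E.
rewrite (bigD1 i) //= mnm1E eqxx big1 => [|j /andP[_ ji]]; last first.
  by rewrite mnm1E -val_eqE /= val_eqE eq_sym (negPf ji).
by [].
Qed.

(** The exponent of t is bounded by the form of any facet X, since rk(X) > 0. *)
Lemma forms_le (a m : 'X_{1..n.+1}) :
  (forall f, @facet_form n s A f a <= facet_form f m) -> (a <= m)%MM.
Proof.
move=> am; have am' i : (a (widen i) <= m (widen i))%N.
  by have := am (inl i); rewrite /= lez_nat.
apply/mnm_lepP => i; have [j ->|->] := unliftP ord_max i.
  have -> : lift ord_max j = widen j by apply: val_inj; rewrite /= /bump leqNgt ltn_ord.
  exact: am'.
pose X : facets := exist (fun X => facet A X) _ (facet_closure1 A_cover (Ordinal n_gt0)).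
have := am (inr X); rewrite /=; set r := rk A _; set sa := (\sum_(_ in _) _)%N.
set sm := (\sum_(_ in _) _)%N.
have : (sa <= sm)%N by apply: leq_sum.
have : (0 < r)%N by apply: rk_gt0 => //; have /and3P[] := valP X.
by nia.
Qed.

(** The coordinates u_i of a lattice vector (u, k) can be prescribed by the values
    of the first n forms, and only the multiple k of the vector of the ranks
    remains free. *)
Lemma lattice_image (c : {ffun form_index A -> int}) :
  (exists w, forall f, c f = ord (@facet_form n s A) f w) <->
  exists k : int, forall X : facets,
    c (inr X) + \sum_(i in val X) c (inl i) = k * (rk A (val X))%:Z.
Proof.
have sumZ (X : {set 'I_n}) (w : 'X_{1..n.+1}) :
    (\sum_(i in X) w (widen i))%N%:Z = \sum_(i in X) (w (widen i))%:Z.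
  by apply: (big_morph Posz PoszD).
split=> [[w cw]|[k kP]].
  exists ((w.1 ord_max)%:Z - (w.2 ord_max)%:Z) => X.
  rewrite cw (eq_bigr (fun i => (w.1 (widen i))%:Z - (w.2 (widen i))%:Z)); last first.
    by move=> i _; rewrite cw.
  by rewrite sumrB /ord /= !sumZ !PoszM; ring.
pose pos (z : int) := if z is Posz m then m else 0%N.
have posK z : (pos z)%:Z - (pos (- z))%:Z = z.
  by case: z => [[|m]|m] //=; rewrite ?subr0 // sub0r NegzE.
(* v 1 and v (-1) are the positive and negative parts of the lattice vector *)
pose v (e : int) :=
  (mnmwiden [multinom pos (e * c (inl i))%R | i < n] + U_(ord_max) *+ pos (e * k)%R)%MM.
have vi e i : v e (widen i) = pos (e * c (inl i)).
  by rewrite mnmDE mnmwiden_widen mulmnE mnm1E mnmE -val_eqE /= gtn_eqF ?mul0n ?addn0.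
have vm e : v e ord_max = pos (e * k).
  by rewrite mnmDE mnmwiden_ordmax mulmnE mnm1E eqxx mul1n.
exists (v 1, v (-1)); case=> [i|X]; rewrite /ord /=.
  by rewrite !vi mul1r mulN1r posK.
rewrite !sumZ !vm !PoszM.
have -> : c (inr X) = k * (rk A (val X))%:Z - \sum_(i in val X) c (inl i) by rewrite -kP addrK.
have -> : \sum_(i in val X) c (inl i) =
    \sum_(i in val X) (v 1 (widen i))%:Z - \sum_(i in val X) (v (-1) (widen i))%:Z.
  by rewrite -sumrB; apply: eq_bigr => i _; rewrite !vi mul1r mulN1r posK.
by rewrite mul1r mulN1r -[in LHS](posK k); ring.
Qed.

Lemma toric_ring_frac_forms (y : {fraction {mpoly K[n.+1]}}) :
  toric_ring_frac A y <-> exists p,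
  y = tofrac p /\ forall m, m \in msupp p -> forall f, 0 <= @facet_form n s A f m.
Proof.
split=> [[p [Rp ->]]|[p [-> pm]]]; exists p; split=> //.
  move=> m mp; apply/(facet_form_ge0P A_cover); exact: ((toric_ringP A_neq0 p).1 Rp).
by apply/toric_ringP => // m mp; apply/(facet_form_ge0P A_cover)/pm.
Qed.

(** The forms u_i take arbitrary values on lattice vectors.  So modulo the orders
    of monomials every vector of orders can be moved to one that is supported on
    the facets X, and then only the powers of t act. *)
Theorem toric_Cl_isogP G : toric_Cl_isog A K G <->
  exists phi : {ffun facets -> int} -> G,
    [/\ forall c c', phi (c + c') = phi c + phi c', forall g, exists c, phi c = g
      & forall c, phi c = 0 <-> exists k : int, forall X, c X = k * (rk A (val X))%:Z].
Proof.
have inj : injective (@FracField.tofrac {mpoly K[n.+1]}).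
  by move=> p q /eqP; rewrite tofrac_eq => /eqP.
rewrite /toric_Cl_isog (Cl_isogP inj (@fraction_quotient _) (@facet_formD n s A)
  toric_ring_frac_forms forms_le facet_interior form_primitive G).
split=> [[psi [psiD psi_surj psi_ker]]|[phi [phiD phi_surj phi_ker]]].
  pose up (c : {ffun facets -> int}) : {ffun form_index A -> int} :=
    [ffun f => if f is inr X then c X else 0].
  have psi0 : psi 0 = 0 by apply: (addrI (psi 0)); rewrite -psiD !addr0.
  exists (psi \o up); split=> [c c'|g|c] /=.
  - by rewrite -psiD; congr psi; apply/ffunP => -[i|X]; rewrite !ffE ?addr0.
  - have [c <-] := psi_surj g.
    exists [ffun X : facets => c (inr X) + \sum_(i in val X) c (inl i)].
    set d := up _; suff E : psi (d - c) = 0 by rewrite -[d](subrK c) psiD E add0r.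
    apply/psi_ker/lattice_image; exists 0 => X; rewrite mul0r !ffE.
    rewrite [X in _ + X = 0](eq_bigr (fun i => - c (inl i))) => [|i _]; last first.
      by rewrite !ffE add0r.
    by rewrite sumrN; ring.
  rewrite psi_ker lattice_image; split=> -[k kP]; exists k => X; have := kP X;
    rewrite !ffE big1 ?addr0 // => i _; by rewrite ffE.
pose dn (c : {ffun form_index A -> int}) : {ffun facets -> int} :=
  [ffun X => c (inr X) + \sum_(i in val X) c (inl i)].
exists (phi \o dn); split=> [c c'|g|c] /=.
- rewrite -phiD; congr phi; apply/ffunP => X; rewrite !ffE.
  under eq_bigr do rewrite ffE.
  by rewrite big_split /=; ring.
- have [c <-] := phi_surj g; exists [ffun f => if f is inr X then c X else 0].
  congr phi; apply/ffunP => X; rewrite !ffE big1 ?addr0 // => i _; by rewrite ffE.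
by rewrite phi_ker lattice_image; split=> -[k kP]; exists k => X; have := kP X; rewrite ffE.
Qed.

End ClassGroup.

(** * Quotients of a free abelian group by one vector *)

Section QuotientByVector.
Variables (T : finType) (r : T -> nat).
Implicit Types (c : {ffun T -> int}) (X : T) (G : zmodType).

(** The map phi identifies G with the quotient of Z^T by the vector r. *)
Definition presents G (phi : {ffun T -> int} -> G) :=
  [/\ forall c c', phi (c + c') = phi c + phi c', forall g, exists c, phi c = g
    & forall c, phi c = 0 <-> exists k : int, forall X, c X = k * (r X)%:Z].

Definition scale_ffun (k : int) c : {ffun T -> int} := [ffun X => k * c X].

Lemma additive_scale_ffun G (phi : {ffun T -> int} -> G) :
  (forall c c', phi (c + c') = phi c + phi c') ->
  forall k c, phi (scale_ffun k c) = phi c *~ k.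
Proof.
move=> phiD; have phi0 : phi 0 = 0 by apply: (addrI (phi 0)); rewrite -phiD !addr0.
have phiN c : phi (- c) = - phi c by apply: (addrI (phi c)); rewrite -phiD !subrr.
elim=> [|k IH|k IH] c.
- by rewrite mulr0z -phi0; congr phi; apply/ffunP => X; rewrite !ffE mul0r.
- by rewrite intS mulrzDr mulr1z -IH -phiD; congr phi; apply/ffunP => X; rewrite !ffE; ring.
rewrite intS opprD mulrzDr mulrN1z -IH -phiN -phiD.
by congr phi; apply/ffunP => X; rewrite !ffE; ring.
Qed.

(** The rank of Z^T / Z r is #T - 1.  With a third element X3, an integral
    combination of two basis vectors in the kernel of phi is up to torsion a
    multiple of r, and vanishes as its entry at X3 is 0. *)
Lemma two_generators (phi : {ffun T -> int} -> int) (e : nat) :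
  (0 < e)%N -> (forall X, 0 < r X)%N ->
  (forall c c', phi (c + c') = phi c + phi c') -> (exists c, phi c = 1) ->
  (forall c k, (forall X, c X = k * (r X)%:Z) -> phi c = 0) ->
  (forall c, phi c = 0 -> exists k : int, forall X, e%:Z * c X = k * (r X)%:Z) ->
  exists X1 X2, X1 != X2 /\ forall X, X = X1 \/ X = X2.
Proof.
move=> e0 r0 phiD [c1 phi1] phir phie.
have phiZ k c : phi (scale_ffun k c) = phi c * k by rewrite additive_scale_ffun // mulrzz.
have [X1 _|noX] := pickP (fun X => true); last first.
  by have : phi c1 = 0 by [apply: (phir _ 0) => X; have := noX X]; rewrite phi1.
have [X2 X21|all1] := pickP (fun X => X != X1); last first.
  have allE X : X = X1 by apply/eqP; have := all1 X; case: eqP.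
  have : phi (scale_ffun (r X1)%:Z c1) = 0.
    by apply: (phir _ (c1 X1)) => X; rewrite ffunE (allE X) mulrC.
  by rewrite phiZ phi1 mul1r => /eqP; rewrite eqz_nat => /eqP E; have := r0 X1; rewrite E.
exists X1, X2; rewrite eq_sym X21; split=> // X3.
have [->|X31] := eqVneq X3 X1; first by left.
have [->|X32] := eqVneq X3 X2; first by right.
pose delta X : {ffun T -> int} := [ffun Y => if Y == X then 1 else 0].
pose a1 := phi (delta X1); pose a2 := phi (delta X2).
have pos X : (r X)%:Z != 0 by rewrite eqz_nat -lt0n.
have ez : e%:Z != 0 by rewrite eqz_nat -lt0n.
have [|k kP] := phie (scale_ffun a2 (delta X1) + scale_ffun (- a1) (delta X2)).
  by rewrite phiD !phiZ -/a1 -/a2; ring.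
have k0 : k = 0.
  have := kP X3; rewrite !ffE (negPf X31) (negPf X32) !mulr0 => /esym/eqP.
  by rewrite mulf_eq0 (negPf (pos _)) orbF => /eqP.
have a10 : a1 = 0.
  have := kP X2; rewrite k0 mul0r !ffE (negPf X21) eqxx mulr0 add0r mulr1 => /eqP.
  by rewrite mulf_eq0 (negPf ez) /= oppr_eq0 => /eqP.
have [l lP] := phie _ a10.
have l0 : l = 0.
  have := lP X2; rewrite ffE (negPf X21) mulr0 => /esym/eqP.
  by rewrite mulf_eq0 (negPf (pos _)) orbF => /eqP.
have := lP X1; rewrite l0 mul0r ffE eqxx mulr1 => /eqP; by rewrite (negPf ez).
Qed.

Lemma presents_two_generators : (forall X, 0 < r X)%N ->
  (exists phi : _ -> int, presents phi) \/
  (exists d, (1 < d)%N /\ exists phi : _ -> (int * 'Z_d)%type, presents phi) ->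
  exists X1 X2, X1 != X2 /\ forall X, X = X1 \/ X = X2.
Proof.
move=> r0 [[phi [phiD phi_surj phi_ker]]|[d [d1 [phi [phiD phi_surj phi_ker]]]]].
  apply: (@two_generators phi 1) => // [c k kP|c /phi_ker[k kP]].
    by apply/phi_ker; exists k.
  by exists k => X; rewrite mul1r.
apply: (@two_generators (fun c => (phi c).1) d) => // [|c c'||c k kP|c c0].
- exact: ltnW.
- by rewrite phiD.
- by have [c cE] := phi_surj (1, 0); exists c; rewrite cE.
- by have /phi_ker -> : exists k : int, forall X, c X = k * (r X)%:Z by exists k.
have /phi_ker[k kP] : phi (scale_ffun d%:Z c) = 0.
  rewrite additive_scale_ffun // -pmulrn; case: (phi c) c0 => [z t] /= ->.
  apply/eqP; rewrite -pair_eqE /=; apply/andP; split.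
    by rewrite raddfMn /= mul0rn.
  rewrite raddfMn /= -mulr_natr -(Zp_nat_mod d1) modnn mulr0 //.
by exists k => X; rewrite -kP ffunE.
Qed.

(** The preimage of (0, 1) in Z^T is a torsion element modulo r, hence is killed by
    phi. *)
Lemma not_both_presented d (phi : _ -> int) (psi : _ -> (int * 'Z_d)%type) :
  (1 < d)%N -> presents phi -> presents psi -> False.
Proof.
move=> d1 [phiD _ phi_ker] [psiD psi_surj psi_ker].
have [c cE] := psi_surj (0, 1).
have /psi_ker/phi_ker : psi (scale_ffun d%:Z c) = 0.
  rewrite additive_scale_ffun // -pmulrn cE.
  apply/eqP; rewrite -pair_eqE /=; apply/andP; split.
    by rewrite raddfMn /= mul0rn.
  by rewrite raddfMn /= -(Zp_nat_mod d1) modnn.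
rewrite additive_scale_ffun // mulrzz => /eqP.
rewrite mulf_eq0 eqz_nat [d == _]gtn_eqF ?orbF; last exact: ltnW.
move=> /eqP/phi_ker/psi_ker; rewrite cE => /(congr1 snd)/eqP.
by rewrite oner_eq0.
Qed.

Lemma intr_Zp_eq0 d (k : int) : (1 < d)%N -> k%:~R = 0 :> 'Z_d <-> exists l : int, k = l * d%:Z.
Proof.
move=> d1; have dR : d%:R = 0 :> 'Z_d by rewrite -(Zp_nat_mod d1) modnn.
split=> [|[l ->]]; last by rewrite intrM -pmulrn dR mulr0.
rewrite {1}(divz_eq k d) intrD intrM -[d%:~R]pmulrn dR mulr0 add0r => k0.
exists (k %/ d)%Z; rewrite {1}(divz_eq k d).
have d0 : d%:Z != 0 by rewrite eqz_nat gtn_eqF // ltnW.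
case E: (k %% d)%Z (modz_ge0 k d0) => [m|//] _.
have lt_m : (m < d)%N.
  by have := ltz_mod k d0; rewrite E ltz_nat.
move: k0; rewrite E -pmulrn => /(congr1 val); rewrite /= val_Zp_nat // modn_small // => ->.
by rewrite addr0.
Qed.

(** With a = r X1 / d, b = r X2 / d and u a + v b = 1, the matrix with the rows
    (b, -a) and (u, v) is unimodular and maps r to (0, d). *)
Lemma two_presentations X1 X2 : X1 != X2 -> (forall X, X = X1 \/ X = X2) ->
  (0 < r X1)%N -> let d := gcdn (r X1) (r X2) in
  (d = 1%N -> exists phi : _ -> int, presents phi) /\
  ((1 < d)%N -> exists phi : _ -> (int * 'Z_d)%type, presents phi).
Proof.
move=> X12 allX r1 d; have d0 : (0 < d)%N by rewrite gcdn_gt0 r1.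
have [a aE] : exists a : nat, r X1 = (a * d)%N by apply/dvdnP/dvdn_gcdl.
have [b bE] : exists b : nat, r X2 = (b * d)%N by apply/dvdnP/dvdn_gcdr.
have [u [v uv]] : exists u v : int, u * a%:Z + v * b%:Z = 1.
  have [u [v E]] := Bezoutz (r X1)%:Z (r X2)%:Z; exists u, v.
  have dz : d%:Z != 0 by rewrite eqz_nat -lt0n.
  apply: (mulIf dz); rewrite mul1r mulrDl -!mulrA -!PoszM -aE -bE E.
  by rewrite /gcdz /=.
pose f c : int := c X1 * b%:Z - c X2 * a%:Z.
pose g c : int := u * c X1 + v * c X2.
have fD c c' : f (c + c') = f c + f c' by rewrite /f !ffE; ring.
have gD c c' : g (c + c') = g c + g c' by rewrite /g !ffE; ring.
have solve (z t : int) : exists c, f c = z /\ g c = t.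
  exists [ffun X => if X == X1 then z * v + t * a%:Z else t * b%:Z - z * u].
  rewrite /f /g !ffunE eqxx eq_sym (negPf X12); split.
    by rewrite -[RHS]mulr1 -uv; ring.
  by rewrite -[RHS]mulr1 -uv; ring.
have ker c : f c = 0 -> c X1 = g c * a%:Z /\ c X2 = g c * b%:Z.
  move/eqP; rewrite subr_eq0 => /eqP E; split; rewrite /g mulrDl.
    transitivity (u * c X1 * a%:Z + v * (c X1 * b%:Z)); last by rewrite E; ring.
    by rewrite -[LHS]mulr1 -uv; ring.
  transitivity (u * (c X2 * a%:Z) + v * c X2 * b%:Z); last by rewrite -E; ring.
  by rewrite -[LHS]mulr1 -uv; ring.
have kerr c k : (forall X, c X = k * (r X)%:Z) -> f c = 0 /\ g c = k * d%:Z.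
  move=> kP; rewrite /f /g !kP aE bE !PoszM; split; first by ring.
  by rewrite -[RHS]mulr1 -uv; ring.
have ext c k : c X1 = k * (r X1)%:Z -> c X2 = k * (r X2)%:Z ->
    forall X, c X = k * (r X)%:Z.
  by move=> E1 E2 X; case: (allX X) => ->.
split=> [d1|d1].
  exists f; split=> [//|z|c]; first by have [c [cz _]] := solve z 0; exists c.
  split=> [/ker[E1 E2]|[k /kerr[]]//]; exists (g c).
  by apply: ext; rewrite ?E1 ?E2 ?aE ?bE d1 muln1.
exists (fun c => (f c, (g c)%:~R)); split=> [c c'|[z t]|c].
- by rewrite fD gD intrD.
- have [c [cz ct]] := solve z (val t)%:Z; exists c; rewrite cz ct; congr (_, _).
  by rewrite -pmulrn natr_Zp.
split=> [E|[k /kerr[-> ->]]]; last first.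
  by rewrite (_ : _%:~R = 0) //; apply/intr_Zp_eq0 => //; exists k.
have /ker[E1 E2] : f c = 0 by have := congr1 fst E.
have /(intr_Zp_eq0 _ d1)[k gE] : (g c)%:~R = 0 :> 'Z_d by have := congr1 snd E.
by exists k; apply: ext; rewrite ?E1 ?E2 ?aE ?bE gE !PoszM; ring.
Qed.

End QuotientByVector.

(** * Polymatroids with two facets *)

Lemma perm_initial_segment s (Q : {set 'I_s}) :
  exists sigma : {perm 'I_s}, forall k, (sigma k \in Q) = (k < #|Q|)%N.
Proof.
pose e := enum Q ++ enum (~: Q).
have ue : uniq e.
  rewrite cat_uniq !enum_uniq andbT /=; apply/hasPn => k.
  by rewrite !mem_enum inE.
have se : size e = s by rewrite size_cat -!cardE cardsC card_ord.
pose f (k : 'I_s) := nth k e k.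
have finj : injective f.
  move=> k l; rewrite /f (set_nth_default k) ?se // => /eqP.
  by rewrite nth_uniq ?se // => /eqP/val_inj.
exists (perm finj) => k; rewrite permE /f nth_cat -cardE.
case: ltnP => kQ; first by rewrite -mem_enum mem_nth // -cardE.
apply/negbTE; rewrite -in_setC -mem_enum mem_nth // -cardE.
by rewrite ltn_subLR // cardsC card_ord.
Qed.

Section TwoFacets.
Variables (n s : nat) (A : 'I_s -> {set 'I_n}).
Hypothesis A_neq0 : forall k, A k != set0.
Hypothesis A_cover : \bigcup_(k < s) A k = [set: 'I_n].
Implicit Types (X P : {set 'I_n}) (i j : 'I_n) (k : 'I_s) (N Q : {set 'I_s}).

Definition two_types P N1 N2 := [/\ P != set0, P != setT, N1 != N2
  & forall i, blocks_of A i = if i \in P then N1 else N2].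

Lemma two_typesC P N1 N2 : two_types P N1 N2 -> two_types (~: P) N2 N1.
Proof.
case=> P0 PT N12 AE; split; rewrite 1?eq_sym //.
- by apply: contraNneq PT => E; rewrite -[P]setCK -E setC0.
- by apply: contraNneq P0 => E; rewrite -[P]setCK -E setCT.
by move=> i; rewrite AE inE; case: (i \in P).
Qed.

Lemma blocks_of_neq0 i : blocks_of A i != set0.
Proof. by have [k iA] := mem_some_block A_cover i; apply/set0Pn; exists k; rewrite inE. Qed.

Lemma two_types_neq0 P N1 N2 : two_types P N1 N2 -> N1 != set0.
Proof.
by case=> /set0Pn[i iP] _ _ /(_ i); rewrite iP => <-; apply: blocks_of_neq0.
Qed.

Lemma blocks_const X N : X != set0 -> (forall i, i \in X -> blocks_of A i = N) -> blocks A X = N.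
Proof.
case/set0Pn => i0 i0X XN; apply/setP => k; apply/blocksP/idP => [[i iX iA]|kN].
  by rewrite -(XN i) // inE.
by exists i0 => //; have := XN _ i0X => /setP/(_ k); rewrite kN inE.
Qed.

Lemma facetE X : facet A X -> X = [set i | blocks_of A i \subset blocks A X].
Proof.
case/and3P => _ /forallP clX _; apply/setP => i; rewrite inE; apply/idP/idP => [iX|iX].
  by rewrite -blocks1; apply: blocksS; rewrite sub1set.
by have /implyP := clX i; apply.
Qed.

(** A facet is determined by the set of blocks that it meets, which is N1, N2 or
    their union.  If N1 and N2 are disjoint, a set that meets both P and its
    complement is separable; if N2 is contained in N1, the union is N1. *)
Lemma two_types_facets P N1 N2 :
  two_types P N1 N2 -> N1 :&: N2 = set0 \/ N2 \subset N1 ->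
  exists X1 X2, [/\ X1 != X2, forall X, facet A X <-> X = X1 \/ X = X2,
    blocks A X1 = N1 & blocks A X2 = N2].
Proof.
move=> tt N12; have [P0 PT neq AE] := tt.
have N10 := two_types_neq0 tt; have N20 := two_types_neq0 (two_typesC tt).
have [i1 i1P] := set0Pn _ P0.
have [i2 i2P] : exists i, i \notin P.
  have [_ /set0Pn[i]] : True /\ ~: P != set0 by split=> //; case: (two_typesC tt).
  by rewrite inE; exists i.
pose cl N := [set i | blocks_of A i \subset N].
have clX X : facet A X -> X = cl (blocks A X) by apply: facetE.
have f1 : facet A (cl N1).
  by have := facet_closure1 A_cover i1; rewrite /closure blocks1 AE i1P.
have f2 : facet A (cl N2).
  by have := facet_closure1 A_cover i2; rewrite /closure blocks1 AE (negPf i2P).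
have N1N2 : ~~ (N1 \subset N2).
  apply/negP => sub; case: N12 => [E|sub']; last by case/negP: neq; rewrite eqEsubset sub.
  by case/negP: N10; rewrite -E (setIidPl sub).
have b1 : blocks A (cl N1) = N1.
  have := blocks_closure A [set i1]; rewrite /closure blocks1 AE i1P //.
have b2 : blocks A (cl N2) = N2.
  have := blocks_closure A [set i2]; rewrite /closure blocks1 AE (negPf i2P) //.
exists (cl N1), (cl N2); split=> // [|X].
  by apply: contraNneq neq => E; rewrite -b1 E b2.
split=> [fX|[->|->]] //; have /and3P[X0 _ iX] := fX.
have [XP|XP] := boolP (X \subset P).
  left; rewrite (clX _ fX); congr cl; apply: blocks_const => // i iX'.
  by rewrite AE (subsetP XP).
have [XP'|XP'] := boolP (X \subset ~: P).
  right; rewrite (clX _ fX); congr cl; apply: blocks_const => // i iX'.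
  by rewrite AE; have := subsetP XP' _ iX'; rewrite inE => /negPf ->.
have [j jX jP] := subsetPn XP; have [i iX'] := subsetPn XP'; rewrite inE negbK => iP.
case: N12 => [E|sub].
  have [||k []] := @inseparableP _ _ A X (X :&: P) iX (subsetIl _ _).
  - by apply/set0Pn; exists i; rewrite inE iX'.
  - by apply: contraNneq jP => EX; move: jX; rewrite -EX inE => /andP[].
  move=> /blocksP[a]; rewrite inE => /andP[_ aP] kA.
  move=> /blocksP[b]; rewrite !inE => /andP[bP bX] kB.
  have : k \in N1 :&: N2.
    have := AE a; rewrite aP => <-; have := AE b.
    move: bP; rewrite bX /= => /negPf -> <-; by rewrite !inE kA.
  by rewrite E inE.
left; rewrite (clX _ fX); congr cl; apply/eqP; rewrite eqEsubset; apply/andP; split.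
  apply/subsetP => k /blocksP[a aX kA]; have : k \in blocks_of A a by rewrite inE.
  by rewrite AE; case: (a \in P) => // /(subsetP sub).
apply/subsetP => k kN; apply/blocksP; exists i => //.
suff : k \in blocks_of A i by rewrite inE.
by rewrite AE iP.
Qed.

(** The closure of every singleton is one of the two facets, which gives the two
    types.  If N1 and N2 meet and are not nested, an element i of P and an element
    j outside form an inseparable pair, whose closure meets N1 and N2 and is thus
    a third facet. *)
Lemma facets_two_types X1 X2 : X1 != X2 -> (forall X, facet A X <-> X = X1 \/ X = X2) ->
  exists P N1 N2, two_types P N1 N2 /\ (N1 :&: N2 = set0 \/ N2 \subset N1).
Proof.
move=> X12 fX; have f1 : facet A X1 by apply/fX; left.
have f2 : facet A X2 by apply/fX; right.
pose P := [set i | closure A [set i] == X1].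
set N1 := blocks A X1; set N2 := blocks A X2.
have AE i : blocks_of A i = if i \in P then N1 else N2.
  rewrite -blocks1 -blocks_closure inE; case: eqP => [->//|].
  by have /fX[->|->] := facet_closure1 A_cover i.
have N12 : N1 != N2.
  by apply: contraNneq X12 => E; rewrite (facetE f1) (facetE f2) -/N1 -/N2 E.
have tt : two_types P N1 N2.
  split=> //.
    apply: contraNneq N12 => P0; apply/eqP/blocks_const; first by have /and3P[] := f1.
    by move=> i _; rewrite AE P0 inE.
  apply: contraNneq N12 => PT; rewrite eq_sym; apply/eqP/blocks_const.
    by have /and3P[] := f2.
  by move=> i _; rewrite AE PT inE.
have [E|meet] := eqVneq (N1 :&: N2) set0; first by exists P, N1, N2; split=> //; left.
have [sub|sub] := boolP (N2 \subset N1); first by exists P, N1, N2; split=> //; right.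
exists (~: P), N2, N1; split; first exact: two_typesC.
right; have [/set0Pn[i iP] _ _ _] := tt; have [/set0Pn[j]] := two_typesC tt.
rewrite inE => jP _ _ _.
have bi : blocks A [set i] = N1 by rewrite blocks1 AE iP.
have bj : blocks A [set j] = N2 by rewrite blocks1 AE (negPf jP).
have ij : i != j by apply: contraNneq jP => <-.
have bij : blocks A [set i; j] = N1 :|: N2.
  by rewrite /blocks bigcup_setU -!/(blocks A _) bi bj.
have iX : inseparable A [set i; j].
  apply/forallP => Y; apply/implyP => /and3P[YX Y0 Yne].
  have Yd : (Y == [set i]) || (Y == [set j]).
    have [iY|iY] := boolP (i \in Y); have [jY|jY] := boolP (j \in Y).
    - by case/negP: Yne; rewrite eqEsubset YX subUset !sub1set iY.
    - apply/orP; left; rewrite eqEsubset sub1set iY andbT; apply/subsetP => a aY.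
      have := subsetP YX _ aY; rewrite !inE => /orP[//|/eqP aj].
      by rewrite -aj aY in jY.
    - apply/orP; right; rewrite eqEsubset sub1set jY andbT; apply/subsetP => a aY.
      have := subsetP YX _ aY; rewrite !inE => /orP[/eqP ai|//].
      by rewrite -ai aY in iY.
    case/set0Pn: Y0 => a aY; have := subsetP YX _ aY; rewrite !inE => /orP[] /eqP E.
      by rewrite -E aY in iY.
    by rewrite -E aY in jY.
  have Di : [set i; j] :\: [set i] = [set j].
    apply/setP => a; rewrite !inE; case: eqP => [->|//] /=.
    by rewrite (negPf ij).
  have Dj : [set i; j] :\: [set j] = [set i].
    apply/setP => a; rewrite !inE; case: (a =P j) => [->|_] /=; rewrite ?orbF //.
    by rewrite eq_sym (negPf ij).
  rewrite -setI_eq0; case/orP: Yd => /eqP ->; rewrite ?Di ?Dj bi bj //.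
  by rewrite setIC.
have f12 : facet A (closure A [set i; j]).
  by apply: facet_closure => //; apply/set0Pn; exists i; rewrite !inE eqxx.
have := blocks_closure A [set i; j]; rewrite bij; case/fX: f12 => ->; rewrite -/N1 -/N2 => E.
  by case/negP: sub; rewrite E subsetUr.
by rewrite E subsetUl.
Qed.

(** In case (i) the two types are B with the first q blocks and C with the others,
    of sizes q and s - q; in case (ii) the elements of B lie in all s blocks and
    the others in the last s - q blocks. *)
Lemma condition_two_types (sigma : {perm 'I_s}) q :
  condition_i (fun k => A (sigma k)) q \/ condition_ii (fun k => A (sigma k)) q ->
  exists P N1 N2, [/\ two_types P N1 N2, N1 :&: N2 = set0 \/ N2 \subset N1
    & gcdn #|N1| #|N2| = gcdn q (s - q)].
Proof.
move=> cond; have qs : (1 <= q < s)%N by case: cond => -[].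
have [q1 /ltnW qs'] := andP qs.
pose Q := [set k | (sigma^-1%g k < q)%N].
have cQ : #|Q| = q.
  rewrite -(card_imset _ (@perm_inj _ sigma^-1%g)).
  have -> : [set sigma^-1%g x | x in Q] = [set k : 'I_s | (k < q)%N].
    apply/setP => k; rewrite inE; apply/imsetP/idP => [[l]|kq].
      by rewrite inE => lq ->.
    by exists (sigma k); rewrite ?inE permK.
  rewrite -sum1dep_card -[RHS]card_ord -sum1_card.
  by rewrite (big_ord_widen s (fun=> 1%N) qs').
have cQ' : #|~: Q| = (s - q)%N by rewrite cardsCs setCK cQ card_ord.
have Qi k : (sigma^-1%g k < q)%N = (k \in Q) by rewrite inE.
have Q0 : Q != set0 by rewrite -card_gt0 cQ.
have Q'0 : ~: Q != set0 by rewrite -card_gt0 cQ' subn_gt0; case/andP: qs.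
case: cond => [[_ [B [C [BC B0 C0 BC0 AE]]]]|[_ [B [B0 BT AE]]]].
  have CE : C = ~: B.
    apply/setP => i; rewrite inE; have := in_setT i; rewrite -BC inE.
    by have := in_set0 i; rewrite -BC0 inE; case: (i \in B); case: (i \in C).
  exists B, Q, (~: Q); split; last by rewrite cQ cQ'.
    split=> // [||i].
    - by apply: contraNneq C0 => BT; rewrite CE BT setCT.
    - by apply: contraNneq Q0 => E; rewrite -(setIid Q) {2}E setICr.
    apply/setP => k; rewrite inE -[k](permKV sigma) AE Qi permKV CE.
    by case kQ: (k \in Q); case iB: (i \in B); rewrite ?in_setC ?kQ ?iB.
  by left; rewrite setICr.
exists B, setT, (~: Q); split; last first.
  by rewrite cardsT card_ord cQ' -[X in gcdn X _](subnKC qs') gcdnC gcdnDr gcdnC.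
  by right; apply: subsetT.
split=> // [||i].
- by move: BT; rewrite properEneq => /andP[].
- by apply: contraNneq Q0 => E; rewrite -[Q]setCK -E setCT.
apply/setP => k; rewrite inE -[k](permKV sigma) AE Qi permKV.
by case kQ: (k \in Q); case iB: (i \in B); rewrite ?in_setC ?in_setT ?kQ ?iB.
Qed.

(** As every block is nonempty, N1 and N2 cover all blocks.  So N2 is the complement
    of N1 in the disjoint case, and N1 consists of all blocks in the nested case;
    the permutation moves N1, respectively the complement of N2, to the front. *)
Lemma two_types_condition P N1 N2 :
  two_types P N1 N2 -> N1 :&: N2 = set0 \/ N2 \subset N1 ->
  exists sigma : {perm 'I_s}, (exists q, condition_i (fun k => A (sigma k)) q) \/
    (exists q, condition_ii (fun k => A (sigma k)) q).
Proof.
move=> tt N12; have [P0 PT neq AE] := tt.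
have N10 := two_types_neq0 tt; have N20 := two_types_neq0 (two_typesC tt).
have [P'0 _ _ _] := two_typesC tt.
have memA k i : (i \in A k) = if i \in P then k \in N1 else k \in N2.
  by have /setP/(_ k) := AE i; rewrite inE => ->; case: (i \in P).
have NT : N1 :|: N2 = setT.
  apply/setP => k; have /set0Pn[i] := A_neq0 k; rewrite memA !inE.
  by case: (i \in P) => ->; rewrite ?orbT.
have bound Q : Q != set0 -> ~: Q != set0 -> (1 <= #|Q| < s)%N.
  by rewrite -!card_gt0; have := cardsC Q; rewrite card_ord; lia.
case: N12 => [E|sub].
  have N2E : N2 = ~: N1.
    apply/setP => k; rewrite inE; have := in_setT k; rewrite -NT inE.
    by have := in_set0 k; rewrite -E inE; case: (k \in N1); case: (k \in N2).
  have [sigma sP] := perm_initial_segment N1; exists sigma; left; exists #|N1|.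
  split; first by rewrite bound // -N2E.
  exists P, (~: P); rewrite setUCr setICr; split=> // k; apply/setP => i.
  rewrite memA N2E -sP.
  by case kN: (sigma k \in N1); case iP: (i \in P); rewrite ?in_setC ?kN ?iP.
have N1T : N1 = setT by rewrite -NT (setUidPl sub).
have [sigma sP] := perm_initial_segment (~: N2); exists sigma; right; exists #|~: N2|.
split.
  rewrite bound ?setCK //; apply: contraNneq neq => E.
  by rewrite -[N2]setCK E setC0 N1T.
exists P; split=> // [|k]; first by rewrite properEneq PT subsetT.
apply/setP => i; rewrite memA N1T -sP.
by case kN: (sigma k \in N2); case iP: (i \in P); rewrite ?in_setT ?in_setC ?kN ?iP ?in_setT.
Qed.

End TwoFacets.

(** For n = 0 the ring is K[t], which is covered by the general description with
    the degree in t as only form. *)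
Lemma toric_Cl_no_variables (K : fieldType) s (A : 'I_s -> {set 'I_0}) (G : zmodType) :
  (forall k, A k != set0) -> toric_Cl_isog A K G -> forall g : G, g = 0.
Proof.
move=> A_neq0; pose deg (_ : unit) (w : 'X_{1..1}) : int := (w ord_max)%:Z.
have degD u a b : deg u (a + b)%MM = deg u a + deg u b by rewrite /deg mnmDE PoszD.
have degP (y : {fraction {mpoly K[1]}}) : toric_ring_frac A y <-> exists p,
    y = tofrac p /\ forall m, m \in msupp p -> forall u, 0 <= deg u m.
  split=> [[p [_ ->]]|[p [-> _]]]; exists p => //; split=> //.
  by apply/toric_ringP => // m _ X; rewrite big1 // => -[].
have deg_le (a m : 'X_{1..1}) : (forall u, deg u a <= deg u m) -> (a <= m)%MM.
  by move=> /(_ tt); rewrite lez_nat => am; apply/mnm_lepP => i; rewrite ord1 -(ord1 ord_max).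
have deg_int (k : int) : exists w, ord deg tt w = k.
  case: k => k.
    exists ((U_(ord_max) *+ k)%MM, 0%MM).
    by rewrite /ord /deg /= mulmnE mnm1E eqxx mnm0E mul1n subr0.
  exists (0%MM, (U_(ord_max) *+ k.+1)%MM).
  by rewrite /ord /deg /= mulmnE mnm1E eqxx mnm0E mul1n sub0r NegzE.
have facet u : exists w, ord deg u w = 0 /\ forall v, v != u -> 0 < ord deg v w.
  by have [w w0] := deg_int 0; case: u; exists w; split=> // -[].
have prim u : exists w, ord deg u w = 1 by case: u; apply: deg_int.
have inj : injective (@FracField.tofrac {mpoly K[1]}).
  by move=> p q /eqP; rewrite tofrac_eq => /eqP.
rewrite /toric_Cl_isog (Cl_isogP inj (@fraction_quotient _) degD degP deg_le facet prim).
case=> psi [_ psi_surj psi_ker] g; have [c <-] := psi_surj g.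
by apply/psi_ker; have [w wE] := deg_int (c tt); exists w; case.
Qed.

Section TwoFacetsClassGroup.
Variables (K : fieldType) (n s : nat) (A : 'I_s -> {set 'I_n}).
Hypothesis A_neq0 : forall k, A k != set0.
Hypothesis A_cover : \bigcup_(k < s) A k = [set: 'I_n].

Lemma facet_rk_gt0 (X : facets A) : (0 < rk A (val X))%N.
Proof. by apply: rk_gt0 => //; have /and3P[] := valP X. Qed.

Lemma condition_n_gt0 (sigma : {perm 'I_s}) q :
  condition_i (fun k => A (sigma k)) q \/ condition_ii (fun k => A (sigma k)) q -> (0 < n)%N.
Proof.
move=> cond; have /andP[q1 qs] : (1 <= q < s)%N by case: cond => -[].
have /set0Pn[i _] := A_neq0 (Ordinal (ltn_trans q1 qs)).
exact: leq_ltn_trans (ltn_ord i).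
Qed.

Lemma condition_Cl (sigma : {perm 'I_s}) q :
  condition_i (fun k => A (sigma k)) q \/ condition_ii (fun k => A (sigma k)) q ->
  let d := gcdn q (s - q) in
  (d = 1%N -> toric_Cl_isog A K int) /\ ((1 < d)%N -> toric_Cl_isog A K (int * 'Z_d)%type).
Proof.
move=> cond; have n0 := condition_n_gt0 cond.
have [P [N1 [N2 [tt N12 <-]]]] := condition_two_types cond.
have [X1 [X2 [X12 fX b1 b2]]] := two_types_facets A_cover tt N12.
have f1 : facet A X1 by apply/fX; left.
have f2 : facet A X2 by apply/fX; right.
pose Y1 : facets A := exist (fun X => facet A X) X1 f1.
pose Y2 : facets A := exist (fun X => facet A X) X2 f2.
have Y12 : Y1 != Y2 by rewrite -val_eqE.
have YE Y : Y = Y1 \/ Y = Y2.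
  by have [E|E] := (fX (val Y)).1 (valP Y); [left|right]; apply: val_inj.
have := @two_presentations _ (fun X : facets A => rk A (val X)) _ _ Y12 YE (facet_rk_gt0 Y1).
rewrite /rk /= b1 b2 => -[p1 pd]; split=> [/p1|/pd] [phi phiP];
  by apply/toric_Cl_isogP => //; exists phi.
Qed.

Lemma Cl_condition : toric_Cl_isog A K int \/
    (exists d, (1 < d)%N /\ toric_Cl_isog A K (int * 'Z_d)%type) ->
  exists sigma : {perm 'I_s},
     (exists q, condition_i (fun k => A (sigma k)) q) \/
     (exists q, condition_ii (fun k => A (sigma k)) q).
Proof.
move=> Cl; have n0 : (0 < n)%N.
  rewrite lt0n; apply/eqP => n0; subst n.
  case: Cl => [/toric_Cl_no_variables|[d [d1 /toric_Cl_no_variables]]].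
    by move=> /(_ A_neq0 1)/eqP; rewrite oner_eq0.
  by move=> /(_ A_neq0 (1, 0))/(congr1 fst)/eqP; rewrite oner_eq0.
have [||Y1 [Y2 [Y12 YE]]] := @presents_two_generators (facets A) (fun X => rk A (val X)).
- exact: facet_rk_gt0.
- have ClP := toric_Cl_isogP K n0 A_neq0 A_cover.
  by case: Cl => [/ClP|[d [d1 /ClP H]]]; [left|right; exists d].
have [P [N1 [N2 [tt N12]]]] :
    exists P N1 N2, two_types A P N1 N2 /\ (N1 :&: N2 = set0 \/ N2 \subset N1).
  apply: (@facets_two_types _ _ A A_cover (val Y1) (val Y2)); first by rewrite val_eqE.
  move=> X; split=> [fX|[->|->]]; [|exact: valP|exact: valP].
  by case: (YE (exist (fun X => facet A X) X fX)) => /(congr1 val) /= ->; [left|right].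
exact: (two_types_condition A_neq0 A_cover tt N12).
Qed.

Lemma Cl_int_torsion_free d : (0 < n)%N -> (1 < d)%N ->
  toric_Cl_isog A K int -> toric_Cl_isog A K (int * 'Z_d)%type -> False.
Proof.
move=> n0 d1 /(toric_Cl_isogP K n0 A_neq0 A_cover)[phi phiP].
move=> /(toric_Cl_isogP K n0 A_neq0 A_cover)[psi psiP].
exact: (not_both_presented d1 phiP psiP).
Qed.

End TwoFacetsClassGroup.

Theorem theorem4p11 (K : fieldType) (n s : nat) (A : 'I_s -> {set 'I_n})
    (A_neq0 : forall k : 'I_s, A k != set0)
    (A_cover : \bigcup_(k < s) A k = [set: 'I_n]) :
  ((toric_Cl_isog A K int \/
    exists d : nat, (1 < d)%N /\ toric_Cl_isog A K (int * 'Z_d)%type)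
   <->
   exists sigma : {perm 'I_s},
     (exists q : nat, condition_i (fun k => A (sigma k)) q) \/
     (exists q : nat, condition_ii (fun k => A (sigma k)) q))
  /\
  (forall (sigma : {perm 'I_s}) (q : nat),
     condition_i (fun k => A (sigma k)) q \/
     condition_ii (fun k => A (sigma k)) q ->
     (toric_Cl_isog A K int <-> coprime q (s - q)) /\
     (forall d : nat, (1 < d)%N -> gcdn q (s - q) = d ->
        toric_Cl_isog A K (int * 'Z_d)%type)).
Proof.
split=> [|sigma q cond]; last first.
  have [Cl1 Cld] := condition_Cl K A_neq0 A_cover cond.
  split=> [|d d1 dE]; last by rewrite -dE; apply: Cld; rewrite dE.
  split=> [ClZ|/eqP/Cl1//].
  have q0 : (0 < q)%N by case: cond => -[/andP[]].
  have : (0 < gcdn q (s - q))%N by rewrite gcdn_gt0 q0.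
  rewrite /coprime leq_eqVlt eq_sym => /orP[//|d1].
  have n0 := condition_n_gt0 A_neq0 cond.
  by case: (Cl_int_torsion_free A_neq0 A_cover n0 d1 ClZ (Cld d1)).
split=> [|[sigma cond]]; first exact: Cl_condition.
have [q condq] : exists q,
    condition_i (fun k => A (sigma k)) q \/ condition_ii (fun k => A (sigma k)) q.
  by case: cond => -[q]; exists q; [left|right].
have [Cl1 Cld] := condition_Cl K A_neq0 A_cover condq.
have q0 : (0 < q)%N by case: condq => -[/andP[]].
have : (0 < gcdn q (s - q))%N by rewrite gcdn_gt0 q0.
rewrite leq_eqVlt => /orP[/eqP d1|d1]; first by left; apply: Cl1.
by right; exists (gcdn q (s - q)); split=> //; apply: Cld.
Qed.
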